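(* There is an absolute constant $c>0$ such that the following holds. Let $u,v\in(0,1)$ and $\beta\in(0,1)$. There are two positive constants $M=M(u,v,\beta)$ and $C(u,v,\beta)$, depending only on $u,v,\beta$, such that for all positive integers $n,N$ satisfying $N\ge Mn$ and every $N\times n$ random matrix $\Gamma=\{\xi_{ij}\}$ whose entries are independent symmetric real random variables with unit variances, identically distributed within each row, and satisfying $\sup_{\lambda\in\mathbb{R}}\mathbb{P}\{|\xi_{ij}-\lambda|\le u\}\le v$ for all $i,j$, one has, with $K_N=\Gamma^*B_1^N$, $$\mathbb{P}\left(K_N\supset C(u,v,\beta)\left(B_\infty^n\cap\sqrt{\ln(N/n)}\,B_2^n\right)\right)\ge1-4\exp\left(-c\,n^\beta N^{1-\beta}\right).$$
   Context: $B_p^m$ denotes the closed unit ball of $\ell_p^m$. $\Gamma^*$ is the transpose of $\Gamma$, so $K_N=\Gamma^*B_1^N$ is the absolute convex hull of the rows of $\Gamma$. *)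

(* Defs.v *)
From HB Require Import structures.
From mathcomp Require Import all_boot all_order all_algebra.
From mathcomp Require Import all_classical all_reals all_analysis.

Set Implicit Arguments.
Unset Strict Implicit.
Unset Printing Implicit Defensive.

Import Order.TTheory GRing.Theory Num.Theory.
Import numFieldNormedType.Exports.

Local Open Scope classical_set_scope.
Local Open Scope ring_scope.

(* Meant for 1 <= p <= +oo. Vectors are columns because K_N applies the
   transpose of Gamma on the left. *)
Definition lp_norm (R : realType) (m : nat) (p : \bar R) (x : 'cV[R]_m) : R :=
  match p with
  | p%:E => (\sum_(i < m) `|x i 0| `^ p) `^ p^-1
  | +oo%E => \big[Num.max/0]_(i < m) `|x i 0|
  | -oo%E => 0
  end.

Definition lp_ball (R : realType) (m : nat) (p : \bar R) : set 'cV[R]_m :=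
  [set x | lp_norm p x <= 1].
Arguments lp_ball {R} m p.

Definition dilate (R : realType) (m : nat) (a : R) (A : set 'cV[R]_m) :
    set 'cV[R]_m :=
  [set a *: x | x in A].

Section random.
Context {d : measure_display} {T : measurableType d} {R : realType}.
Variable P : probability T R.

Definition mutually_independent (I : finType) (X : I -> {RV P >-> R}) : Prop :=
  forall (J : {set I}) (A : I -> set R),
    (forall i, measurable (A i)) ->
    P (\bigcap_(i in [set` J]) (X i @^-1` A i)) =
    (\prod_(i in J) P (X i @^-1` A i))%E.

Definition same_distribution (X Y : T -> R) : Prop :=
  forall A : set R, measurable A -> pushforward P X A = pushforward P Y A.

Definition symmetric_rv (X : {RV P >-> R}) : Prop :=
  same_distribution X (\- X).

Definition levy_concentration (X : {RV P >-> R}) (u : R) : \bar R :=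
  ereal_sup [set P [set w | `|X w - l| <= u] | l in [set: R]].

Section matrix.
Variables (N n : nat) (xi : 'I_N -> 'I_n -> {RV P >-> R}).

Definition random_matrix (w : T) : 'M[R]_(N, n) := \matrix_(i, j) xi i j w.

Definition K_N (w : T) : set 'cV[R]_n :=
  [set (random_matrix w)^T *m x | x in lp_ball N 1%:E].

End matrix.
End random.

(* Main.v *)
Require Import Defs.
From HB Require Import structures.
From mathcomp Require Import all_boot all_order all_algebra.
From mathcomp Require Import all_classical all_reals all_analysis.
From mathcomp Require Import measurable_realfun lra ring.

(** By convex duality K_N contains C L, where L is the body of the theorem, as
    soon as every y has a row with |<G_i, y>| at least C times the support
    function of L at y.  Let k be of order ln (N / n) and, for b : [n] -> [k],
    let |y|_b be the sum over the k blocks of b of the l2-norms of y.  Any x in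
    L has all its block l2-norms bounded for a suitable b, so <x, y> is at most
    a constant times |y|_b.  For a fixed y one row satisfies
    |<G_i, y>| >= t |y|_b with probability at least c 2^-k: the law of a row is
    invariant under sign changes, flipping the sign of each block costs 2^-k,
    and Paley-Zygmund controls the sum of the absolute block sums.  As 2^-k is
    at least of order (n / N)^(beta / 2), Chernoff's bound yields many such rows
    with l2-norm O(sqrt (n 2^k)), outside an event of probability
    exp (- c N 2^-k).  A union bound over a lattice net of exponential size in n
    and a rounding whose error is controlled by the Hilbert-Schmidt norm of the
    rows kept (no operator norm bound is available with two moments only)
    extend this to all y. *)

Set Implicit Arguments.
Unset Strict Implicit.
Unset Printing Implicit Defensive.

Import Order.TTheory GRing.Theory Num.Theory.
Import numFieldNormedType.Exports.

Local Open Scope classical_set_scope.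
Local Open Scope ring_scope.

(** * Blocks and rounding *)

Lemma exists_le_avg (R : realFieldType) (k : nat) (f : 'I_k -> R) (S : R) :
  (0 < k)%N -> \sum_c f c <= S -> exists c, f c <= S / k%:R.
Proof.
move=> k0 fS; apply/existsP; apply: contraT; rewrite negb_exists => /forallP H.
have k0R : 0 < k%:R :> R by rewrite ltr0n.
suff : \sum_(c < k) (S / k%:R) < \sum_c f c.
  by rewrite sumr_const card_ord -(mulr_natr (S / _)) divfK ?gt_eqF// ltNge fS.
apply: ltr_sum => [|c _]; last by rewrite ltNge.
by apply/hasP; exists (Ordinal k0) => //; exact: mem_index_enum.
Qed.

(* Greedy allocation: each new item goes to a block whose load is at most
   the average. *)
Lemma balanced_blocks (R : realFieldType) (J : finType) (k : nat) (w : J -> R)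
    (L : R) :
  (0 < k)%N -> (forall j, 0 <= w j <= 1) -> \sum_j w j <= L ->
  exists b : J -> 'I_k, forall c, \sum_(j | b j == c) w j <= L / k%:R + 1.
Proof.
move=> k0 w01 wL.
have L0 : 0 <= L / k%:R.
  by rewrite divr_ge0 ?ler0n//; apply: le_trans wL; apply: sumr_ge0 => j _; case/andP: (w01 j).
suff /(_ (index_enum J) (index_enum_uniq J) wL) [b Hb] : forall s : seq J, uniq s ->
    \sum_(j <- s) w j <= L ->
    exists b : J -> 'I_k, forall c, \sum_(j <- s | b j == c) w j <= L / k%:R + 1.
  by exists b.
elim=> [_ _|j s IH /= /andP[js us]].
  by exists (fun=> Ordinal k0) => c; rewrite big_nil; lra.
rewrite big_cons => sL.
have /andP[wj0 wj1] := w01 j.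
have {}sL : \sum_(i <- s) w i <= L by lra.
have [b Hb] := IH us sL.
have [|c0 Hc0] := @exists_le_avg _ _ (fun c => \sum_(i <- s | b i == c) w i) L k0.
  apply: le_trans sL; rewrite [leRHS](partition_big b predT)//=.
exists (fun i => if i == j then c0 else b i) => c; rewrite big_cons eqxx.
have -> : \sum_(i <- s | (if i == j then c0 else b i) == c) w i =
          \sum_(i <- s | b i == c) w i.
  rewrite big_seq_cond [RHS]big_seq_cond; apply: eq_bigl => i.
  by have [->|//] := eqVneq i j; rewrite (negbTE js).
by have [<-|_] := eqVneq; [lra|exact: Hb].
Qed.

(** Cauchy-Schwarz, from sum (b x_j - a y_j)^2 >= 0 with a and b the two l2-norms. This yields the
    claim multiplied by ab, hence the separate cases a = 0 and b = 0. *)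
Lemma sum_sq_CS (R : rcfType) (J : finType) (Q : pred J) (x y : J -> R) :
  \sum_(j | Q j) x j * y j <=
  Num.sqrt (\sum_(j | Q j) x j ^+ 2) * Num.sqrt (\sum_(j | Q j) y j ^+ 2).
Proof.
set A := \sum_(j | Q j) x j ^+ 2; set B := \sum_(j | Q j) y j ^+ 2.
have A0 : 0 <= A by apply: sumr_ge0 => j _; exact: sqr_ge0.
have B0 : 0 <= B by apply: sumr_ge0 => j _; exact: sqr_ge0.
set a := Num.sqrt A; set b := Num.sqrt B.
have a0 : 0 <= a := sqrtr_ge0 _. have b0 : 0 <= b := sqrtr_ge0 _.
have ea : A = a ^+ 2 by rewrite sqr_sqrtr.
have eb : B = b ^+ 2 by rewrite sqr_sqrtr.
have [a00|an0] := eqVneq a 0.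
  rewrite a00 mul0r big1// => j Qj; apply/eqP; rewrite mulf_eq0 -sqrf_eq0.
  have /eqP : A = 0 by rewrite ea a00 expr0n.
  by rewrite /A psumr_eq0 => [/allP/(_ j (mem_index_enum _))|i _]; rewrite ?Qj ?sqr_ge0//= => ->.
have [b00|bn0] := eqVneq b 0.
  rewrite b00 mulr0 big1// => j Qj; apply/eqP; rewrite mulf_eq0 orbC -sqrf_eq0.
  have /eqP : B = 0 by rewrite eb b00 expr0n.
  by rewrite /B psumr_eq0 => [/allP/(_ j (mem_index_enum _))|i _]; rewrite ?Qj ?sqr_ge0//= => ->.
have ap : 0 < a by rewrite lt_def an0.
have bp : 0 < b by rewrite lt_def bn0.
have : 0 <= \sum_(j | Q j) (b * x j - a * y j) ^+ 2.
  by apply: sumr_ge0 => j _; exact: sqr_ge0.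
have -> : \sum_(j | Q j) (b * x j - a * y j) ^+ 2 =
   b ^+ 2 * A + a ^+ 2 * B - 2 * (a * b) * \sum_(j | Q j) x j * y j.
  by rewrite /A /B !mulr_sumr -big_split/= -sumrB; apply: eq_bigr => j _; ring.
rewrite ea eb => h.
have {}h : 0 <= (a * b) * (a * b - \sum_(j | Q j) x j * y j) by nra.
by move: h; rewrite pmulr_rge0 ?mulr_gt0// subr_ge0.
Qed.

Lemma sqrt_sum_sqD (R : rcfType) (J : finType) (Q : pred J) (x y : J -> R) :
  Num.sqrt (\sum_(j | Q j) (x j + y j) ^+ 2) <=
  Num.sqrt (\sum_(j | Q j) x j ^+ 2) + Num.sqrt (\sum_(j | Q j) y j ^+ 2).
Proof.
have := sum_sq_CS Q x y.
set A := \sum_(j | Q j) x j ^+ 2; set B := \sum_(j | Q j) y j ^+ 2 => h.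
have A0 : 0 <= A by apply: sumr_ge0 => j _; exact: sqr_ge0.
have B0 : 0 <= B by apply: sumr_ge0 => j _; exact: sqr_ge0.
rewrite -[leRHS]ger0_norm ?addr_ge0 ?sqrtr_ge0// -sqrtr_sqr ler_sqrt ?sqr_ge0//.
have -> : \sum_(j | Q j) (x j + y j) ^+ 2 = A + B + 2 * \sum_(j | Q j) x j * y j.
  by rewrite mulr_sumr /A /B -!big_split/=; apply: eq_bigr => j _; ring.
by rewrite sqrrD !sqr_sqrtr// mulr2n; lra.
Qed.

Lemma sum_sq_le_sq_sum (R : realDomainType) (J : finType) (f : J -> R) :
  (forall j, 0 <= f j) -> \sum_j f j ^+ 2 <= (\sum_j f j) ^+ 2.
Proof.
move=> f0; rewrite expr2 mulr_suml; apply: ler_sum => j _.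
rewrite expr2 ler_wpM2l// (bigD1 j)//= lerDl.
by apply: sumr_ge0 => i _.
Qed.

(** Maximised over [b], this is up to constants the K-functional between l1 and l2, that is, the
    support function of B_oo intersected with sqrt k B_2. *)
Definition block_norm (R : rcfType) (J : finType) (k : nat) (b : J -> 'I_k)
  (y : J -> R) : R := \sum_c Num.sqrt (\sum_(j | b j == c) y j ^+ 2).

Section block_norm.
Context (R : rcfType) (J : finType) (k : nat) (b : J -> 'I_k).
Implicit Types x y : J -> R.

Lemma block_norm_ge0 y : 0 <= block_norm b y.
Proof. by apply: sumr_ge0 => c _; exact: sqrtr_ge0. Qed.

Lemma block_normD x y :
  block_norm b (fun j => x j + y j) <= block_norm b x + block_norm b y.
Proof. by rewrite -big_split/=; apply: ler_sum => c _; exact: sqrt_sum_sqD. Qed.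

Lemma block_normZ a y : 0 <= a -> block_norm b (fun j => a * y j) = a * block_norm b y.
Proof.
move=> a0; rewrite mulr_sumr; apply: eq_bigr => c _.
rewrite -{2}(ger0_norm a0) -sqrtr_sqr -sqrtrM ?sqr_ge0// mulr_sumr.
by congr Num.sqrt; apply: eq_bigr => j _; rewrite exprMn.
Qed.

Lemma block_norm_mono x y : (forall j, `|x j| <= `|y j|) ->
  block_norm b x <= block_norm b y.
Proof.
move=> xy; apply: ler_sum => c _; rewrite ler_sqrt; last first.
  by apply: sumr_ge0 => j _; exact: sqr_ge0.
by apply: ler_sum => j _; rewrite -(real_normK (num_real (x j))) -(real_normK (num_real (y j))) lerXn2r ?nnegrE.
Qed.

(** The factor k is crude, but the lattice mesh later carries a factor 2^-k, and k <= 2^k absorbs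
    it. *)
Lemma block_norm_le y : block_norm b y <= k%:R * Num.sqrt (\sum_j y j ^+ 2).
Proof.
have -> : k%:R * Num.sqrt (\sum_j y j ^+ 2) = \sum_(c < k) Num.sqrt (\sum_j y j ^+ 2).
  by rewrite sumr_const card_ord mulr_natl.
apply: ler_sum => c _; rewrite ler_sqrt ?sumr_ge0// => [|j _]; last exact: sqr_ge0.
rewrite [leLHS]big_mkcond; apply: ler_sum => j _.
by case: ifP => // _; exact: sqr_ge0.
Qed.

Lemma sum_sq_le_block_norm y : \sum_j y j ^+ 2 <= block_norm b y ^+ 2.
Proof.
rewrite (partition_big b predT)//=.
rewrite (eq_bigr (fun c => Num.sqrt (\sum_(j | b j == c) y j ^+ 2) ^+ 2)) => [|c _].
  by apply: sum_sq_le_sq_sum => c; exact: sqrtr_ge0.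
by rewrite sqr_sqrtr// sumr_ge0// => j _; exact: sqr_ge0.
Qed.

Lemma pairing_le_block_norm (M : R) x y :
  (forall c, \sum_(j | b j == c) x j ^+ 2 <= M) ->
  \sum_j x j * y j <= Num.sqrt M * block_norm b y.
Proof.
move=> xM; rewrite (partition_big b predT)//= mulr_sumr; apply: ler_sum => c _.
apply: le_trans (sum_sq_CS _ _ _) _; rewrite ler_wpM2r ?sqrtr_ge0//.
rewrite ler_sqrt//; apply: le_trans (xM c); apply: sumr_ge0 => j _; exact: sqr_ge0.
Qed.

End block_norm.

(* Derandomized rounding: each coordinate is rounded up or down so as not to
   exceed the average over the two choices, weighted to be unbiased. *)
Lemma rounding (R : archiRealFieldType) (I J : finType) (g : I -> J -> R)
    (y : J -> R) (eta : R) : 0 < eta ->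
  exists z : J -> int, (forall j, `|y j - eta * (z j)%:~R| <= eta) /\
    \sum_i (\sum_j g i j * (y j - eta * (z j)%:~R)) ^+ 2 <=
      eta ^+ 2 * \sum_i \sum_j g i j ^+ 2.
Proof.
move=> eta0.
suff /(_ (index_enum J) (index_enum_uniq J)) [z [z1 z2]] : forall s : seq J, uniq s ->
    exists z : J -> int, (forall j, `|y j - eta * (z j)%:~R| <= eta) /\
    \sum_i (\sum_(j <- s) g i j * (y j - eta * (z j)%:~R)) ^+ 2 <=
      eta ^+ 2 * \sum_i \sum_(j <- s) g i j ^+ 2 by exists z.
have fl j : exists th : R, [/\ 0 <= th, th <= 1 & y j = eta * ((Num.floor (y j / eta))%:~R + th)].
  have := floor_itv (y j / eta); rewrite intrD => /andP[h1 h2].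
  exists (y j / eta - (Num.floor (y j / eta))%:~R); split; [lra|lra|].
  by rewrite addrC subrK mulrC divfK// gt_eqF.
elim=> [_|j s IH /= /andP[js us]].
  exists (fun j => Num.floor (y j / eta)); split.
    move=> j; have [th [th0 th1]] := fl j; set f := Num.floor _ => ->.
    by rewrite -mulrBr addrAC subrr add0r normrM !ger0_norm ?(ltW eta0)// ler_piMr// ltW.
  rewrite [X in _ * X]big1 ?mulr0; last by move=> i _; rewrite big_nil.
  by rewrite big1// => i _; rewrite big_nil expr0n.
have [z [z1 z2]] := IH us.
have [th [th0 th1 yE]] := fl j.
move: yE; set f := Num.floor _ => yE.
pose S i := \sum_(j <- s) g i j * (y j - eta * (z j)%:~R).
(* It suffices to pick one of the two integers next to y_j / eta so that the sum of squares grows by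
   at most eta^2 times the squares of column j. *)
have H (e : int) : `|y j - eta * e%:~R| <= eta ->
    \sum_i (S i + g i j * (y j - eta * e%:~R)) ^+ 2 <=
      \sum_i S i ^+ 2 + eta ^+ 2 * \sum_i g i j ^+ 2 ->
    exists z : J -> int, (forall j, `|y j - eta * (z j)%:~R| <= eta) /\
    \sum_i (\sum_(j <- j :: s) g i j * (y j - eta * (z j)%:~R)) ^+ 2 <=
      eta ^+ 2 * \sum_i \sum_(j <- j :: s) g i j ^+ 2.
  move=> e1 e2; exists (fun i => if i == j then e else z i); split.
    by move=> i; case: eqP => [->|].
  have -> : \sum_i \sum_(j0 <- j :: s) g i j0 ^+ 2 = \sum_i g i j ^+ 2 + \sum_i \sum_(j <- s) g i j ^+ 2.
    by rewrite -big_split/=; apply: eq_bigr => i _; rewrite big_cons.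
  rewrite mulrDr addrC; apply: le_trans (le_trans e2 _); last by rewrite lerD2r.
  apply: ler_sum => i _; rewrite big_cons eqxx addrC.
  rewrite le_eqVlt; apply/orP; left; apply/eqP; congr ((_ + _) ^+ 2).
  rewrite /S !big_seq; apply: eq_bigr => i' i's.
  by case: eqP => // ?; subst i'; rewrite i's in js.
pose A := \sum_i S i * g i j; pose B := \sum_i g i j ^+ 2.
have B0 : 0 <= B by apply: sumr_ge0 => i _; exact: sqr_ge0.
have E (r : R) : \sum_i (S i + g i j * r) ^+ 2 = \sum_i S i ^+ 2 + 2 * r * A + r ^+ 2 * B.
  by rewrite /A /B !mulr_sumr -!big_split/=; apply: eq_bigr => i _; ring.
have r0 : y j - eta * f%:~R = eta * th by rewrite yE; ring.
have r1 : y j - eta * (f + 1)%:~R = eta * (th - 1) by rewrite yE intrD; ring.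
(* The cross term 2 r A is linear in the residual r, and the residuals eta th and eta (th - 1) have
   opposite signs: the one making it nonpositive is chosen. *)
have [A0|A0] := leP A 0.
- apply: (H f); rewrite r0.
    by rewrite normrM !ger0_norm ?(ltW eta0)// ler_piMr// ltW.
  rewrite E -addrA lerD2l.
  have : eta * th * A <= 0 by rewrite mulr_ge0_le0// mulr_ge0// ltW.
  have : (eta * th) ^+ 2 * B <= eta ^+ 2 * B.
    by rewrite ler_wpM2r// exprMn ler_piMr ?sqr_ge0// expr_le1.
  rewrite /B; lra.
- apply: (H (f + 1)); rewrite r1.
    rewrite normrM (ger0_norm (ltW eta0)) ler_piMr ?(ltW eta0)//.
    by rewrite ler_norml; lra.
  rewrite E -addrA lerD2l.
  have : eta * (1 - th) * A >= 0 by rewrite mulr_ge0 ?(ltW A0)// mulr_ge0 ?(ltW eta0)//; lra.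
  have : (eta * (th - 1)) ^+ 2 * B <= eta ^+ 2 * B.
    rewrite ler_wpM2r// exprMn ler_piMr ?sqr_ge0// -[leLHS]real_normK ?num_real//.
    by rewrite expr_le1// ler_norml; lra.
  rewrite /B; lra.
Qed.

(** * Rademacher sums *)

Section rademacher.
Context (R : rcfType) (J : finType).
Implicit Types (s : seq J) (a : J -> R) (e : {ffun J -> bool}).

Definition signed_sum s a e : R := \sum_(j <- s) (-1) ^+ e j * a j.

Let flip (j : J) e : {ffun J -> bool} := [ffun i => (i == j) (+) e i].

Let flipK j : involutive (flip j).
Proof. by move=> e; apply/ffunP => i; rewrite !ffunE addKb. Qed.

(** Flipping the sign at [j] alone permutes the sign vectors and negates every term. *)
Lemma sum_sign_mul (j : J) (g : {ffun J -> bool} -> R) :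
  (forall e e', (forall i, i != j -> e i = e' i) -> g e = g e') ->
  \sum_(e : {ffun J -> bool}) (-1) ^+ e j * g e = 0.
Proof.
move=> gj; set S := \sum_(e : {ffun J -> bool}) _.
suff : S = - S by move/eqP; rewrite -subr_eq0 opprK -mulr2n mulrn_eq0 => /eqP.
rewrite {1}/S (reindex_inj (can_inj (flipK j)))/= -sumrN.
apply: eq_bigr => e _; rewrite ffunE eqxx addTb signrN mulNr; congr (- (_ * _)).
by apply: gj => i /negbTE ij; rewrite ffunE ij.
Qed.

Lemma signed_sum_eq s a e e' : {in s, e =1 e'} -> signed_sum s a e = signed_sum s a e'.
Proof.
by move=> ee; rewrite /signed_sum !big_seq; apply: eq_bigr => j js; rewrite ee.
Qed.

Let signed_sum_out j s a (js : j \notin s) e e' :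
  (forall i, i != j -> e i = e' i) -> signed_sum s a e = signed_sum s a e'.
Proof.
by move=> ee; apply: signed_sum_eq => i si; apply: ee; apply: contraNneq js => <-.
Qed.

Lemma signed_sum_sq s a : uniq s ->
  \sum_(e : {ffun J -> bool}) signed_sum s a e ^+ 2 = #|{ffun J -> bool}|%:R * \sum_(j <- s) a j ^+ 2.
Proof.
elim: s => [_|j s IH /= /andP[js us]].
  by rewrite big_nil mulr0 big1// => e _; rewrite /signed_sum big_nil expr0n.
rewrite big_cons mulrDr -IH// addrC.
have -> : #|{ffun J -> bool}|%:R * a j ^+ 2 = \sum_(e : {ffun J -> bool}) a j ^+ 2.
  by rewrite sumr_const mulr_natl.
have E e : signed_sum (j :: s) a e ^+ 2 =
    signed_sum s a e ^+ 2 + a j ^+ 2 + 2 * a j * ((-1) ^+ e j * signed_sum s a e).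
  rewrite /signed_sum big_cons -/(signed_sum s a e).
  by case: (e j); rewrite ?expr0 ?expr1; ring.
rewrite (eq_bigr _ (fun e _ => E e)) !big_split/= [X in _ + X](_ : _ = 0) ?addr0//.
by rewrite -mulr_sumr (sum_sign_mul (signed_sum_out a js)) mulr0.
Qed.

(** Odd powers of the new sign cancel in (S + e_j a_j)^4, leaving S^4 + 6 a_j^2 S^2 + a_j^4. With A
    the previous sum of squares, the induction closes by 3 A^2 + 6 a_j^2 A + a_j^4 <= 3 (A +
    a_j^2)^2. *)
Lemma signed_sum_pow4 s a : uniq s ->
  \sum_(e : {ffun J -> bool}) signed_sum s a e ^+ 4 <=
  3 * #|{ffun J -> bool}|%:R * (\sum_(j <- s) a j ^+ 2) ^+ 2.
Proof.
elim: s => [_|j s IH /= /andP[js us]].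
  by rewrite big_nil expr0n mulr0 big1// => e _; rewrite /signed_sum big_nil expr0n.
have so := signed_sum_out a js.
have z1 := sum_sign_mul so.
have z3 : \sum_(e : {ffun J -> bool}) (-1) ^+ e j * (signed_sum s a e) ^+ 3 = 0.
  by apply: (@sum_sign_mul j (fun e => signed_sum s a e ^+ 3)) => e e' /so ->.
have -> : \sum_(e : {ffun J -> bool}) signed_sum (j :: s) a e ^+ 4 = \sum_(e : {ffun J -> bool}) signed_sum s a e ^+ 4 +
   6 * a j ^+ 2 * \sum_(e : {ffun J -> bool}) signed_sum s a e ^+ 2 + #|{ffun J -> bool}|%:R * a j ^+ 4.
  have -> : #|{ffun J -> bool}|%:R * a j ^+ 4 = \sum_(e : {ffun J -> bool}) a j ^+ 4.
    by rewrite sumr_const mulr_natl.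
  have E e : signed_sum (j :: s) a e ^+ 4 =
      signed_sum s a e ^+ 4 + 6 * a j ^+ 2 * signed_sum s a e ^+ 2 + a j ^+ 4 +
      4 * a j * ((-1) ^+ e j * signed_sum s a e ^+ 3) +
      4 * a j ^+ 3 * ((-1) ^+ e j * signed_sum s a e).
    rewrite /signed_sum big_cons -/(signed_sum s a e).
    by case: (e j); rewrite ?expr0 ?expr1; ring.
  by rewrite (eq_bigr _ (fun e _ => E e)) !big_split/= -!mulr_sumr z1 z3 !mulr0 !addr0.
rewrite signed_sum_sq// big_cons; move: (IH us).
set m := #|_|%:R; set A := \sum_(j <- s) _; set X := a j => h.
have m0 : 0 <= m by exact: ler0n.
have : 0 <= m * X ^+ 4 by rewrite mulr_ge0// exprn_even_ge0.
nra.
Qed.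

(** This minorant turns bounds on the second and fourth moments into a lower bound for E|x|. With r
    = |x| / s the gap is s r / 12 times r^3 - 9 r + 12, whose minimum on r >= 0 is near 7 / 4. For s
    = 0 the left side is 0, since inverting 0 gives 0. *)
Let abs_ge_quartic (s x : R) : 0 <= s -> 3 / 4 * (x ^+ 2 / s) - x ^+ 4 / (12 * s ^+ 3) <= `|x|.
Proof.
rewrite le_eqVlt => /predU1P[<-|s0].
  by rewrite expr0n/= !mulr0 invr0 !mulr0 subr0 normr_ge0.
rewrite -(real_normK (num_real x)) -[x ^+ 4]/(x ^+ (2 * 2)) exprM -(real_normK (num_real x)).
have := normr_ge0 x; set t := `|x| => t0.
have [r tE] : exists r, t = r * s by exists (t / s); rewrite divfK// gt_eqF.
have r0 : 0 <= r by rewrite -(pmulr_lge0 _ s0) -tE.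
rewrite tE.
have -> : 3 / 4 * ((r * s) ^+ 2 / s) - ((r * s) ^+ 2) ^+ 2 / (12 * s ^+ 3) =
    s * (3 / 4 * r ^+ 2 - r ^+ 4 / 12) by field; rewrite gt_eqF.
rewrite (mulrC r) ler_pM2l// -subr_ge0.
have -> : r - (3 / 4 * r ^+ 2 - r ^+ 4 / 12) =
  r / 12 * ((r - 7 / 4) ^+ 2 * (r + 7 / 2) + 3 / 16 * r + 41 / 32) by field.
have : 0 <= (r - 7 / 4) ^+ 2 * (r + 7 / 2) by rewrite mulr_ge0 ?sqr_ge0//; lra.
by move=> h; rewrite mulr_ge0//; lra.
Qed.

(** Averaging the quartic minorant at s = r, the l2-norm of [a], gives (3/4 - 3/12) r: the second
    moment is r^2 and the fourth at most 3 r^4. *)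
Lemma khinchine_L1 s a : uniq s ->
  #|{ffun J -> bool}|%:R / 2 * Num.sqrt (\sum_(j <- s) a j ^+ 2) <=
  \sum_(e : {ffun J -> bool}) `|signed_sum s a e|.
Proof.
move=> us; set r := Num.sqrt _; set m := #|_|%:R.
have r0 : 0 <= r by exact: sqrtr_ge0.
have rE : \sum_(j <- s) a j ^+ 2 = r ^+ 2.
  by rewrite sqr_sqrtr// sumr_ge0// => j _; exact: sqr_ge0.
have [r00|rn0] := eqVneq r 0; first by rewrite r00 mulr0 sumr_ge0.
have rp : 0 < r by rewrite lt_def rn0.
apply: le_trans (ler_sum _ (fun e _ => abs_ge_quartic (signed_sum s a e) r0)).
rewrite big_split/= sumrN -mulr_sumr -!mulr_suml signed_sum_sq// rE -/m.
have -> : m / 2 * r = 3 / 4 * (m * r ^+ 2 / r) - 3 * m * (r ^+ 2) ^+ 2 / (12 * r ^+ 3).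
  by field.
rewrite lerD2l lerN2 ler_wpM2r ?invr_ge0 ?mulr_ge0 ?exprn_ge0//.
by rewrite -rE signed_sum_pow4.
Qed.

Section blocks.
Context (k : nat) (b : J -> 'I_k).

Let blk (c : 'I_k) := [seq j <- index_enum J | b j == c].

Let blk_uniq c : uniq (blk c).
Proof. by rewrite filter_uniq// index_enum_uniq. Qed.

Let block_normE a : block_norm b a = \sum_c Num.sqrt (\sum_(j <- blk c) a j ^+ 2).
Proof. by apply: eq_bigr => c _; rewrite big_filter. Qed.

(* Paley-Zygmund: sum_c |S_c| has mean at least half the block norm, while its
   second moment is controlled by that of the S_c. *)
Lemma card_abs_block_sums a :
  #|{ffun J -> bool}|%:R <= 16 *
  #|[pred e : {ffun J -> bool} | block_norm b a / 4 <= \sum_c `|signed_sum (blk c) a e|]|%:R :> R.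
Proof.
set m := #|{ffun J -> bool}|%:R; set G := [pred e | _].
have m0 : 0 <= m by exact: ler0n.
pose s c := Num.sqrt (\sum_(j <- blk c) a j ^+ 2).
have s0 c : 0 <= s c by exact: sqrtr_ge0.
have sE c : \sum_(j <- blk c) a j ^+ 2 = s c ^+ 2.
  by rewrite sqr_sqrtr// sumr_ge0// => j _; exact: sqr_ge0.
set B := block_norm b a; have BE : B = \sum_c s c by exact: block_normE.
have [B0|Bn0] := eqVneq B 0.
  rewrite (_ : #|G| = #|{ffun J -> bool}|) -/m; first lra.
  by apply: eq_card => e; rewrite !inE -/B B0 mul0r sumr_ge0.
have Bp : 0 < B by rewrite lt_def Bn0/= BE sumr_ge0.
(* Off [G] the sum is below B / 4. On [G], each block satisfies |S_c| <= S_c^2 / (8 s_c) + 2 s_c,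
   and the s_c add up to B. *)
have pt e : \sum_c `|signed_sum (blk c) a e| <=
    B / 4 + 8^-1 * \sum_c signed_sum (blk c) a e ^+ 2 / s c + 2 * B * (e \in G)%:R.
  have q0 : 0 <= 8^-1 * \sum_c signed_sum (blk c) a e ^+ 2 / s c.
    by rewrite mulr_ge0 ?invr_ge0 ?ler0n ?sumr_ge0// => c _; rewrite mulr_ge0 ?sqr_ge0 ?invr_ge0.
  have [_|eG] := boolP (e \in G); last first.
    by move: eG; rewrite inE -ltNge -/B => eG; rewrite mulr0 addr0; lra.
  rewrite mulr1 -addrA; apply: ler_wpDl; first by rewrite divr_ge0// ltW.
  rewrite BE !mulr_sumr -big_split/=; apply: ler_sum => c _.
  have [sc0|sn0] := eqVneq (s c) 0.
    rewrite sc0 invr0 !mulr0 addr0 (_ : signed_sum _ _ _ = 0) ?normr0// /signed_sum big_seq big1// => j jc.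
    have /eqP := sE c; rewrite sc0 expr0n/= psumr_eq0 => [/allP/(_ j jc)|i _]; last exact: sqr_ge0.
    by rewrite /= sqrf_eq0 => /eqP ->; rewrite mulr0.
  have sp : 0 < s c by rewrite lt_def sn0 s0.
  rewrite -(real_normK (num_real (signed_sum _ _ _))); set t := `|_|.
  rewrite -subr_ge0 (_ : _ - _ = 8^-1 * ((t - 4 * s c) ^+ 2 / s c)); last by field; rewrite gt_eqF.
  by rewrite mulr_ge0 ?invr_ge0 ?ler0n// mulr_ge0 ?sqr_ge0// invr_ge0.
(* On average the pointwise bound is B / 4 + B / 8 + 2 B #|G| / m. Against the lower bound B / 2
   this leaves #|G| >= m / 16. *)
have : \sum_(e : {ffun J -> bool}) \sum_c `|signed_sum (blk c) a e| <=
    m * (B / 4) + m / 8 * B + 2 * B * #|G|%:R.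
  apply: le_trans (ler_sum _ (fun e _ => pt e)) _.
  rewrite !big_split/= sumr_const -[X in X + _ + _]mulr_natl; apply: lerD; last first.
    rewrite -mulr_sumr -natr_sum -(sum1_card G) [in leRHS]big_mkcond/=.
    by rewrite (eq_bigr (fun e => if e \in G then 1%N else 0%N)) // => e _; case: ifP.
  rewrite lerD2l -mulr_sumr exchange_big/= (mulrC m) -mulrA ler_wpM2l ?invr_ge0 ?ler0n//.
  rewrite BE mulr_sumr ler_sum// => c _; rewrite -mulr_suml signed_sum_sq// sE -/m.
  have [->|sn0] := eqVneq (s c) 0; first by rewrite invr0 !mulr0.
  by rewrite expr2 !mulrA mulfK.
have : m / 2 * B <= \sum_(e : {ffun J -> bool}) \sum_c `|signed_sum (blk c) a e|.
  rewrite exchange_big/= BE mulr_sumr ler_sum// => c _; exact: khinchine_L1.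
move=> h1 h2; have {h1 h2} := le_trans h1 h2.
set g := #|G|%:R => h.
have : 0 <= B * (16 * g - m) by lra.
by rewrite pmulr_rge0// subr_ge0.
Qed.

Let twist (t : {ffun 'I_k -> bool}) (e : {ffun J -> bool}) : {ffun J -> bool} :=
  [ffun j => t (b j) (+) e j].

Let twistK t : involutive (twist t).
Proof. by move=> e; apply/ffunP => i; rewrite !ffunE addKb. Qed.

Let signed_sum_twist t a e :
  signed_sum (index_enum J) a (twist t e) = \sum_c (-1) ^+ t c * signed_sum (blk c) a e.
Proof.
rewrite /signed_sum (partition_big b predT)//=; apply: eq_bigr => c _.
rewrite mulr_sumr /blk big_filter; apply: eq_bigr => j /eqP bj.
by rewrite ffunE bj signr_addb mulrA.
Qed.

(* Multiplying all the signs of a block by a common random sign keeps the sign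
   vector uniform, and with probability 2^-k the new block sums are all
   nonnegative. *)
Lemma card_signed_sum_ge a :
  #|{ffun J -> bool}|%:R <= 16 * 2 ^+ k *
  #|[pred e : {ffun J -> bool} | block_norm b a / 4 <= signed_sum (index_enum J) a e]|%:R :> R.
Proof.
apply: le_trans (card_abs_block_sums a) _.
rewrite -mulrA ler_wpM2l// -natrX -natrM ler_nat.
set G := [pred e | _]; set H := [pred e | _].
(* Double counting of the pairs (t, e) with [twist t e] in [H]: each [t] contributes #|H| pairs, and
   each [e] in [G] lies in at least one, for [t] the signs of its block sums. *)
have -> : (2 ^ k * #|H| = \sum_(t : {ffun 'I_k -> bool}) \sum_(e : {ffun J -> bool}) (twist t e \in H))%N.
  rewrite -[k in (2 ^ k)%N]card_ord -card_bool -card_ffun -sum_nat_const; apply: eq_bigr => t _.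
  by rewrite (reindex_inj (can_inj (twistK t)))/= -sum1_card big_mkcond/=; apply: eq_bigr => e _; rewrite twistK.
rewrite exchange_big/= -sum1_card big_mkcond/=; apply: leq_sum => e _.
case: ifPn => // eG; rewrite (bigD1 [ffun c => signed_sum (blk c) a e < 0])//=.
rewrite (_ : (_ \in H) = true) ?leq_addr// inE signed_sum_twist.
apply: le_trans eG _; apply: ler_sum => c _; rewrite ffunE.
by rewrite -normrEsign.
Qed.

End blocks.
End rademacher.

(** * Size of the net *)

(** As exp (1 / r) >= 1 + 1 / r, the ratio is at most r / (1 + r), and the full series with that
    ratio sums to 1 + r. *)
Lemma geometric_sum_le (R : realType) (m : nat) (r : R) : 0 < r ->
  \sum_(a < m) expR (- r^-1) ^+ a <= 1 + r.
Proof.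
move=> r0; set x := expR _.
have x0 : 0 <= x by exact: expR_ge0.
have x1 : 1 / (1 + r) <= 1 - x.
  have : x <= r / (1 + r).
    rewrite /x expRN -[leRHS]invrK lef_pV2 ?posrE ?expR_gt0 ?invr_gt0 ?divr_gt0 ?addr_gt0//.
    apply: le_trans (expR_ge1Dx _).
    by rewrite invf_div mulrDl divff ?gt_eqF// mul1r addrC.
  by move=> h; rewrite (_ : 1 / (1 + r) = 1 - r / (1 + r)) ?lerB//; field; rewrite gt_eqF// addr_gt0.
have : (1 - x) * \sum_(a < m) x ^+ a <= 1.
  by rewrite -[1 - x]opprB mulNr -subrX1; have := exprn_ge0 m x0; lra.
have s0 : 0 <= \sum_(a < m) x ^+ a by apply: sumr_ge0 => a _; exact: exprn_ge0.
move=> h; have : 1 / (1 + r) * \sum_(a < m) x ^+ a <= 1.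
  by apply: le_trans h; rewrite ler_wpM2r.
by rewrite mulrAC mul1r ler_pdivrMr ?addr_gt0// mul1r.
Qed.

(* Chernoff-type count: each point of the l1-ball is weighted by
   exp (n - |z|_1 / r) >= 1. *)
Lemma card_l1_ball (R : realType) (J : finType) (m : nat) (r : R) : 0 < r ->
  #|[pred f : {ffun J -> bool * 'I_m} | (\sum_j (f j).2)%N%:R <= #|J|%:R * r]|%:R
  <= (2 * expR 1 * (1 + r)) ^+ #|J|.
Proof.
move=> r0; set G := [pred f | _]; set x := expR (- r^-1).
have -> : (2 * expR 1 * (1 + r)) ^+ #|J| = expR 1 ^+ #|J| * \prod_(j : J) (2 * (1 + r)).
  by rewrite prodr_const -exprMn; congr (_ ^+ _); ring.
apply: (@le_trans _ _ (expR 1 ^+ #|J| * \prod_(j : J) \sum_(p : bool * 'I_m) x ^+ p.2)).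
  rewrite bigA_distr_bigA/= mulr_sumr -(sum1_card G) natr_sum big_mkcond/=.
  apply: ler_sum => f _; case: ifPn => [|_]; last first.
    by rewrite mulr_ge0 ?exprn_ge0 ?expR_ge0// prodr_ge0// => j _; rewrite exprn_ge0// expR_ge0.
  rewrite inE => fG; rewrite prodrXr /x -!expRM_natl -expRD -[leLHS]expR0 ler_expR mulr1.
  by rewrite mulrN subr_ge0 ler_pdivrMr.
rewrite ler_wpM2l ?exprn_ge0 ?expR_ge0//; apply: ler_prod => j _; apply/andP; split.
  by apply: sumr_ge0 => p _; rewrite exprn_ge0// expR_ge0.
rewrite -(pair_bigA _ (fun (c : bool) (a : 'I_m) => x ^+ a))/= sumr_const card_bool -[leLHS]mulr_natl.
by rewrite ler_wpM2l// geometric_sum_le.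
Qed.

(** * Independence of rows *)

(** Measurable boxes form a pi-system containing the whole space and generate the product
    sigma-algebra, so a finite measure is determined by its values on them. *)
Definition cylinder (R : realType) (J : finType) : set (set (J -> R)) :=
  [set [set x | forall j, A j (x j)] |
     A in [set A : J -> set R | forall j, measurable (A j)]].

Notation coord_space R J := (g_sigma_algebraType (@cylinder R J)).

Section coord_space.
Context (R : realType) (J : finType).

Lemma setI_closed_cylinder : setI_closed (@cylinder R J).
Proof.
move=> _ _ [A mA <-] [B mB <-]; exists (fun j => A j `&` B j).
  by move=> j; exact: measurableI.
by apply/seteqP; split => [x h|x [h1 h2] j]; split; move=> //; move=> j; have [] := h j.
Qed.

Lemma cylinderT : cylinder [set: J -> R].
Proof.
by exists (fun=> setT) => [j|]; [exact: measurableT|apply/seteqP; split].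
Qed.

Lemma measurable_coord (j : J) :
  measurable_fun [set: coord_space R J] (fun x : coord_space R J => x j).
Proof.
move=> _ A mA; rewrite setTI; apply: sub_sigma_algebra.
exists (fun i => if i == j then A else setT); first by move=> i /=; case: ifP.
apply/seteqP; split => x /=; first by move=> /(_ j); rewrite eqxx.
by move=> Ax i; case: eqP => // ->.
Qed.

Lemma measurable_cylinder_preimage d (T : measurableType d) (X : J -> T -> R)
    (A : J -> set R) : (forall j, measurable_fun [set: T] (X j)) ->
  (forall j, measurable (A j)) -> measurable [set w | forall j, A j (X j w)].
Proof.
move=> mX mA; rewrite (_ : [set w | _] = \bigcap_(j in [set: J]) (X j @^-1` A j)).
  apply: fin_bigcap_measurable => [|j _]; first exact: finite_finset.
  by rewrite -[X in measurable X]setTI; exact: mX.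
by apply/seteqP; split => w h => [j _|j]; exact: h.
Qed.

Lemma measurable_to_coord_space d (T : measurableType d) (X : J -> T -> R) :
  (forall j, measurable_fun [set: T] (X j)) ->
  measurable_fun [set: T] (fun w => (fun j => X j w) : coord_space R J).
Proof.
move=> mX; apply: (@measurability _ _ T (coord_space R J) setT _ (@cylinder R J)) => //.
move=> _ [_ [A mA <-] <-]; rewrite setTI.
exact: measurable_cylinder_preimage.
Qed.

Lemma cylinder_measure_unique (m1 m2 : {measure set (coord_space R J) -> \bar R}) :
  (m1 setT < +oo)%E -> (forall A, cylinder A -> m1 A = m2 A) ->
  forall A, measurable A -> m1 A = m2 A.
Proof.
move=> m1T m12 A mA; apply: (@measure_unique _ R (coord_space R J) (@cylinder R J) (fun=> setT)) => //.
- exact: setI_closed_cylinder.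
- by move=> _; exact: cylinderT.
- by rewrite bigcup_const.
Qed.

End coord_space.

Section rows.
Context d (T : measurableType d) (R : realType) (P : probability T R).
Context (I J : finType) (X : I -> J -> {RV P >-> R}).
Hypothesis indep : mutually_independent (fun ij : I * J => X ij.1 ij.2).

Let row (i : I) (w : T) : coord_space R J := fun j => X i j w.

Let mrow i : measurable_fun setT (row i).
Proof. by apply: measurable_to_coord_space => j; exact: measurable_funPT. Qed.

Let mrowP i B : measurable B -> measurable (row i @^-1` B).
Proof. by move=> mB; rewrite -[X in measurable X]setTI; exact: mrow. Qed.

Lemma probability_cylinder_row (i : I) (A : J -> set R) :
  (forall j, measurable (A j)) ->
  P [set w | forall j, A j (X i j w)] = (\prod_j P (X i j @^-1` A j))%E.
Proof.
move=> mA.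
pose A' (ij : I * J) := A ij.2.
have -> : [set w | forall j, A j (X i j w)] =
    \bigcap_(ij in [set` [set ij : I * J | ij.1 == i]%SET]) (X ij.1 ij.2 @^-1` A' ij).
  apply/seteqP; split => w /= h.
    by move=> [i' j] /=; rewrite inE/= => /eqP ->; exact: h.
  by move=> j; apply: (h (i, j)); rewrite /= inE/=.
rewrite indep; last by move=> ij; exact: mA.
rewrite (reindex_onto (fun j => (i, j)) (fun ij => ij.2))/=; last first.
  by move=> [i' j] /=; rewrite inE/= => /eqP ->.
by apply: eq_bigl => j; rewrite inE/= !eqxx.
Qed.

Let probability_cylinder (A : I -> J -> set R) :
  (forall i j, measurable (A i j)) ->
  P [set w | forall i j, A i j (X i j w)] =
  (\prod_i P [set w | forall j, A i j (X i j w)])%E.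
Proof.
move=> mA; under eq_bigr => i _ do rewrite probability_cylinder_row//.
rewrite pair_bigA/=.
have -> : [set w | forall i j, A i j (X i j w)] =
    \bigcap_(ij in [set` [set: I * J]%SET]) (X ij.1 ij.2 @^-1` A ij.1 ij.2).
  apply/seteqP; split => w /= h; first by move=> [i j] _ /=; exact: h.
  by move=> i j; apply: (h (i, j)); rewrite /= inE.
rewrite (indep _ (fun ij => mA ij.1 ij.2)).
by apply: eq_bigl => j; rewrite inE.
Qed.

(* Starting from cylinders, the rows are upgraded to arbitrary measurable sets
   one at a time. *)
Lemma independent_rows (B : I -> set (coord_space R J)) :
  (forall i, measurable (B i)) ->
  P [set w | forall i, B i (fun j => X i j w)] =
  (\prod_i P [set w | B i (fun j => X i j w)])%E.
Proof.
suff H (s : seq I) : forall B : I -> set (coord_space R J),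
    (forall i, measurable (B i)) -> (forall i, i \notin s -> cylinder (B i)) ->
    P [set w | forall i, B i (row i w)] = (\prod_i P (row i @^-1` B i))%E.
  by move=> mB; apply: (H (enum I)) => // i; rewrite mem_enum.
elim: s => [C mC cC|i s IH C mC cC].
  have /choice[A hA] i : exists A : J -> set R,
      (forall j, measurable (A j)) /\ C i = [set x | forall j, A j (x j)].
    by have [A mA <-] := cC i isT; exists A.
  rewrite (_ : [set w | _] = [set w | forall i j, A i j (X i j w)]); last first.
    apply/seteqP; split => w /= h i; first by have := h i; rewrite (hA i).2.
    by rewrite (hA i).2; exact: h.
  rewrite probability_cylinder; last by move=> i; exact: (hA i).1.
  by apply: eq_bigr => i _; rewrite (hA i).2.
pose D := [set w | forall i', i' != i -> C i' (row i' w)].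
have mD : measurable D.
  rewrite (_ : D = \bigcap_(i' in [set i' | i' != i]) (row i' @^-1` C i')).
    by apply: fin_bigcap_measurable => [|i' _]; [exact: finite_finset|exact: mrowP].
  by [].
pose q := (\prod_(i' | i' != i) P (row i' @^-1` C i'))%E.
have q0 : (0 <= fine q)%R by rewrite fine_ge0// prode_ge0.
have qE : q = (fine q)%:E.
  by rewrite fineK// /q; elim/big_ind : _ => // [x y xf yf|i' _]; [exact: fin_numM|apply: fin_num_measure; exact: mrowP].
(* With the other rows frozen in the event [D], both measures are finite measures of the set allowed
   to row [i]. They agree on boxes by induction, hence on every measurable set. *)
pose m1 := pushforward (mrestr P mD) (row i).
pose m2 := pushforward (mscale (NngNum q0) P) (row i).
have m1E A : m1 A = P (row i @^-1` A `&` D) by [].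
have m2E A : m2 A = (q * P (row i @^-1` A))%E by rewrite qE.
have key C' : measurable C' -> m1 C' = m2 C'.
  apply: (@cylinder_measure_unique _ _ m1 m2).
    rewrite /m1/= /pushforward/= /mrestr.
    by rewrite preimage_setT setTI; apply: le_lt_trans (ltry 1); exact: probability_le1.
  move=> A cA; rewrite [LHS]m1E [RHS]m2E.
  have mA : @measurable _ (coord_space R J) A by exact: sub_sigma_algebra.
  pose C'' i' := if i' == i then A else C i'.
  have C''i : C'' i = A by rewrite /C'' eqxx.
  have := IH C''; rewrite (bigD1 i)//= C''i.
  rewrite (_ : [set w | _] = row i @^-1` A `&` D); last first.
    apply/seteqP; split => w /=.
      move=> h; split; first by have := h i; rewrite /C'' eqxx.
      by move=> i' i'i; have := h i'; rewrite /C'' (negbTE i'i).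
    by move=> [h1 h2] i'; rewrite /C''; case: eqP => [->//|/eqP]; exact: h2.
  move=> ->; last 2 first.
  - by move=> i'; rewrite /C''; case: ifP.
  - move=> i' i's; rewrite /C''; case: eqP => // /eqP i'i.
    by apply: cC; rewrite inE negb_or i'i.
  rewrite muleC; congr (_ * _)%E; apply: eq_bigr => i' i'i.
  by rewrite /C'' (negbTE i'i).
rewrite (bigD1 i)//= -/q.
rewrite (_ : [set w | _] = row i @^-1` C i `&` D).
  by have := key _ (mC i); rewrite m1E m2E muleC.
apply/seteqP; split => w /=; first by move=> h; split => // i' _.
by move=> [h1 h2] i'; have [->//|] := eqVneq i' i; exact: h2.
Qed.

Hypothesis sym : forall i j, symmetric_rv (X i j).

(** On boxes the law of the row factors over its entries, and each factor is unchanged by a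
    reflection. Boxes determine the law. *)
Lemma sign_invariant_row (i : I) (e : J -> bool) (B : set (coord_space R J)) :
  measurable B ->
  P [set w | B (fun j => (-1) ^+ e j * X i j w)] = P [set w | B (fun j => X i j w)].
Proof.
pose r (w : T) : coord_space R J := fun j => (-1) ^+ e j * X i j w.
have mr : measurable_fun setT r.
  apply: measurable_to_coord_space => j; apply: measurable_funM => //.
pose m1 := pushforward P r; pose m2 := pushforward P (row i).
apply: (@cylinder_measure_unique _ _ m1 m2).
  by rewrite /m1/= /pushforward/= preimage_setT probability_setT ltry.
move=> _ [A mA <-].
rewrite /m1 /m2 /pushforward/=.
pose A' j := if e j then -%R @^-1` A j else A j.
have mA' j : measurable (A' j).
  by rewrite /A'; case: (e j) => //; rewrite -[X in measurable X]setTI; exact: oppr_measurable.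
rewrite [LHS](_ : _ = P [set w | forall j, A' j (X i j w)]); last first.
  congr (P _); apply/seteqP; split => w /= h j; have := h j; rewrite /A' /r;
    by case: (e j); rewrite ?expr1 ?expr0 ?mulN1r ?mul1r.
rewrite [RHS](_ : _ = P [set w | forall j, A j (X i j w)])//.
rewrite !probability_cylinder_row//; apply: eq_bigr => j _.
rewrite /A'; case: (e j) => //.
by have := sym i j (mA j); rewrite /pushforward => ->.
Qed.

End rows.

Lemma measure_exists_le d (T : measurableType d) (R : realType)
    (P : {measure set T -> \bar R}) (E : finType) (Q : pred E) (F : E -> set T) :
  (forall e, measurable (F e)) ->
  (P [set w | exists2 e, Q e & F e w] <= \sum_(e | Q e) P (F e))%E.
Proof.
move=> mF.
suff H (s : seq E) : measurable (\big[setU/set0]_(e <- s | Q e) F e) /\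
    (P (\big[setU/set0]_(e <- s | Q e) F e) <= \sum_(e <- s | Q e) P (F e))%E.
  rewrite (_ : [set w | _] = \big[setU/set0]_(e <- index_enum E | Q e) F e).
    exact: (H _).2.
  apply/seteqP; split => [w [e Qe Few]|w]; rewrite -bigcup_seq_cond.
    by exists e => //=; rewrite mem_index_enum.
  by move=> [e /= /andP[_ Qe] Few]; exists e.
elim: s => [|e s [mU IH]]; first by rewrite !big_nil measure0.
rewrite !big_cons; case: ifP => // _; split; first exact: measurableU.
apply: (le_trans (measureU2 _ (mF e) mU)); exact: leeD.
Qed.

(* Exponential Markov inequality for E exp(-count), expanded over the atoms. *)
Lemma chernoff_count d (T : measurableType d) (R : realType)
    (P : probability T R) (I : finType) (A : I -> set T) (p : R) :
  (forall i, measurable (A i)) ->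
  (forall e : {ffun I -> bool}, P [set w | forall i, (if e i then A i else ~` A i) w] =
     (\prod_i P (if e i then A i else ~` A i))%E) ->
  (forall i, (p%:E <= P (A i))%E) ->
  (P [set w | (#|[pred i | `[< A i w >]]|%:R <= #|I|%:R * p / 4)%R] <=
    (expR (- (#|I|%:R * p / 4)))%:E)%E.
Proof.
move=> mA indA pA.
pose a i := fine (P (A i)).
have aE i : P (A i) = (a i)%:E by rewrite fineK// fin_num_measure.
have ap i : p <= a i by rewrite -lee_fin -aE.
have a01 i : 0 <= a i <= 1.
  by rewrite -!lee_fin -aE measure_ge0 probability_le1.
set m := #|I|%:R * p / 4.
pose Q := [pred e : {ffun I -> bool} | #|[pred i | e i]|%:R <= m :> R].
pose F (e : {ffun I -> bool}) := [set w | forall i, (if e i then A i else ~` A i) w].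
have mAe (e : {ffun I -> bool}) i : measurable (if e i then A i else ~` A i).
  by case: (e i) => //; exact: measurableC.
have mF e : measurable (F e).
  rewrite (_ : F e = \bigcap_(i in [set: I]) (if e i then A i else ~` A i)).
    by apply: fin_bigcap_measurable => [|i _]; [exact: finite_finset|].
  by apply/seteqP; split => w h => [i _|i]; exact: h.
have -> : [set w | #|[pred i | `[< A i w >]]|%:R <= m :> R] = [set w | exists2 e, Q e & F e w].
  apply/seteqP; split => w /=.
    move=> h; exists [ffun i => `[< A i w >]]; last first.
      by move=> i; rewrite ffunE; case: asboolP.
    rewrite /Q/= (_ : #|_| = #|[pred i | `[< A i w >]]|)//.
    by apply: eq_card => i; rewrite !inE ffunE.
  move=> [e Qe Fe]; rewrite (_ : #|_| = #|[pred i | e i]|)//.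
  apply: eq_card => i; rewrite !inE; have := Fe i.
  by case: (e i) => h; [apply/asboolP|apply/asboolPn].
apply: le_trans (measure_exists_le _ _ mF) _.
pose g i (c : bool) := if c then a i else 1 - a i.
have PF e : P (F e) = (\prod_i g i (e i))%:E.
  rewrite indA -prodEFin; apply: eq_bigr => i _; rewrite /g; case: (e i) => //.
  by rewrite probability_setC// aE.
rewrite (eq_bigr _ (fun e _ => PF e)) sumEFin lee_fin.
have g0 i c : 0 <= g i c by rewrite /g; have /andP[] := a01 i; case: c; lra.
(* The constraint count <= m is bounded by exp (m - count); [h] puts one factor exp (- 1) on each
   event that occurs, so that the sum over atoms factorises. *)
pose h i (c : bool) := if c then expR (- 1) * a i else 1 - a i.
apply: (@le_trans _ _ (\sum_(e : {ffun I -> bool}) expR m * \prod_i h i (e i))).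
  rewrite [leLHS]big_mkcond; apply: ler_sum => e _.
  have -> : \prod_i h i (e i) = expR (- #|[pred i | e i]|%:R) * \prod_i g i (e i).
    have -> : expR (- #|[pred i | e i]|%:R) = \prod_i (if e i then expR (- 1) else 1) :> R.
      by rewrite -big_mkcond prodr_const -expRM_natl mulrN1.
    rewrite -big_split/=; apply: eq_bigr => i _.
    by rewrite /h /g; case: (e i); rewrite ?mul1r.
  case: ifPn => [Qe|_]; last by rewrite !mulr_ge0 ?expR_ge0// prodr_ge0.
  rewrite mulrA -expRD ler_peMl ?prodr_ge0// -[leLHS]expR0 ler_expR.
  by rewrite subr_ge0.
rewrite -mulr_sumr -(bigA_distr_bigA h).
apply: (@le_trans _ _ (expR m * \prod_(i : I) expR (- (p / 2)))); last first.
  rewrite prodr_const -expRM_natl -expRD ler_expR /m.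
  by rewrite le_eqVlt; apply/orP; left; apply/eqP; field.
rewrite ler_wpM2l ?expR_ge0//; apply: ler_prod => i _; rewrite big_bool/= /h.
have /andP[a0 a1] := a01 i.
have e0 := @expR_ge0 R (- 1).
(* Each factor is 1 - (1 - exp (- 1)) a_i <= 1 - p / 2 <= exp (- p / 2), which pays for exp m with m
   = #|I| p / 4 and leaves exp (- m). *)
have e1 : expR (- 1) <= 1 / 2 :> R.
  rewrite expRN div1r lef_pV2 ?posrE ?expR_gt0//.
  by apply: le_trans (expR_ge1Dx _).
apply/andP; split; first by rewrite addr_ge0 ?mulr_ge0//; lra.
apply: le_trans (expR_ge1Dx _); have := ap i; nra.
Qed.

(** * Duality *)

(** The l1-ball is compact. Continuity is asked on row vectors, the type that carries the
    finite-dimensional normed topology. *)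
Lemma l1_ball_argmin (R : realType) (N : nat) (f : ('I_N -> R) -> R) :
  continuous (fun a : 'rV[R]_N => f (fun i => a 0 i)) ->
  exists2 a : 'I_N -> R, \sum_i `|a i| <= 1 &
    forall b : 'I_N -> R, \sum_i `|b i| <= 1 -> f a <= f b.
Proof.
move=> cf; pose A : set 'rV[R]_N := [set a | \sum_i `|a 0 i| <= 1].
have cA : compact A.
  apply: bounded_closed_compact.
    exists 1; split => // M M1 a aA /=; rewrite /Num.norm/= mx_normrE.
    apply: bigmax_le => [|[i j] _]/=; first by rewrite (le_trans _ (ltW M1)).
    rewrite ord1; apply: le_trans (ltW M1); apply: le_trans aA.
    by rewrite (bigD1 j)//= lerDl sumr_ge0.
  rewrite (_ : A = (fun a : 'rV[R]_N => \sum_i `|a 0 i|) @^-1` [set x | x <= 1])//.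
  apply: closed_comp; last exact: closed_le.
  move=> a _; move: a; apply: continuous_big => [|i _ a]; first exact: add_continuous.
  exact: (continuous_comp (@coord_continuous R 1 N 0 i a) (@norm_continuous _ _ _)).
have A0 : A !=set0 by exists 0; rewrite /A/= big1// => i _; rewrite mxE normr0.
have [a + amin] := compact_EVT_min A0 cA (continuous_subspaceT cf).
rewrite inE => aA; exists (fun i => a 0 i) => // b bA.
have bE : (fun i => (\row_i b i) 0 i) = b by apply/funext => i; rewrite mxE.
by have := amin (\row_i b i); rewrite inE bE; apply; rewrite /A/= -[X in \sum_i `|X i|]bE in bA *.
Qed.

(* Separation by the residual r of the nearest point G^T a: optimality of a
   gives |<G_i, r>| <= <x, r> - |r|^2 for every i. *)
Lemma mem_absconv_hull (R : realType) (N n : nat) (G : 'I_N -> 'I_n -> R) (x : 'I_n -> R) :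
  (forall y : 'I_n -> R, exists i, \sum_j x j * y j <= `|\sum_j G i j * y j|) ->
  exists2 a : 'I_N -> R, \sum_i `|a i| <= 1 & forall j, \sum_i G i j * a i = x j.
Proof.
move=> H; pose f (a : 'I_N -> R) : R := \sum_j (x j - \sum_i G i j * a i) ^+ 2.
have [|a aA amin] := @l1_ball_argmin R N f.
  apply: continuous_big => [|j _ a]; first exact: add_continuous.
  apply: (@continuous_comp _ _ _ (fun b : 'rV[R]_N => x j - \sum_i G i j * b 0 i)
    (fun t : R => t ^+ 2)); last exact: exprn_continuous.
  apply: (@continuousB R R^o _ (fun=> x j) (fun b : 'rV[R]_N => \sum_i G i j * b 0 i)).
    exact: cst_continuous.
  move: a; apply: continuous_big => [|i _ a]; first exact: add_continuous.
  apply: (@continuousM R _ (fun=> G i j) (fun b : 'rV[R]_N => b 0 i)).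
    exact: cst_continuous.
  exact: coord_continuous.
pose r j := x j - \sum_i G i j * a i.
(* First-order optimality: moving from [a] towards [b] by s in [0, 1] changes f by - 2 s X + s^2 Y,
   which cannot be negative. *)
have var (b : 'I_N -> R) : \sum_i `|b i| <= 1 ->
    \sum_j r j * (\sum_i G i j * (b i - a i)) <= 0.
  move=> bA; pose D j := \sum_i G i j * (b i - a i); change (\sum_j r j * D j <= 0).
  set X := \sum_j _; rewrite leNgt; apply/negP => X0.
  pose Y := \sum_j D j ^+ 2.
  have Y0 : 0 <= Y by apply: sumr_ge0 => j _; exact: sqr_ge0.
  have fs (s : R) : 0 <= s <= 1 -> 2 * s * X <= s ^+ 2 * Y.
    move=> /andP[s0 s1].
    pose c i := (1 - s) * a i + s * b i.
    have cA : \sum_i `|c i| <= 1.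
      apply: (@le_trans _ _ (\sum_i ((1 - s) * `|a i| + s * `|b i|))).
        apply: ler_sum => i _; apply: le_trans (ler_normD _ _) _.
        rewrite !normrM (ger0_norm s0) (@ger0_norm _ (1 - s))//; lra.
      rewrite big_split/= -!mulr_sumr.
      have := ler_wpM2l s0 bA; have s1' : 0 <= 1 - s by lra.
      by have := ler_wpM2l s1' aA; lra.
    have := amin c cA.
    have -> : f c = f a - 2 * s * X + s ^+ 2 * Y.
      rewrite /f /X /Y !mulr_sumr -sumrB -big_split/=; apply: eq_bigr => j _.
      have -> : \sum_i G i j * c i = \sum_i G i j * a i + s * D j.
        rewrite /D mulr_sumr -big_split/=; apply: eq_bigr => i _; rewrite /c; ring.
      by rewrite -/(r j) opprD addrA -/(r j); ring.
    lra.
  (* If X were positive, the minimiser s = X / Y, or s = 1 when X / Y leaves [0, 1], would decrease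
     f. *)
  have [XY|YX] := leP X Y.
    have Yp : 0 < Y by exact: lt_le_trans XY.
    have := fs (X / Y); rewrite divr_ge0 ?(ltW X0)// ler_pdivrMr// mul1r XY => /(_ isT).
    rewrite (_ : 2 * (X / Y) * X = 2 * (X ^+ 2 / Y)); last by ring.
    rewrite (_ : (X / Y) ^+ 2 * Y = X ^+ 2 / Y); last by field; rewrite gt_eqF.
    have : 0 < X ^+ 2 / Y by rewrite divr_gt0// exprn_gt0.
    lra.
  by have := fs 1; rewrite ler01 lexx => /(_ isT); lra.
have rb (b : 'I_N -> R) : \sum_i `|b i| <= 1 ->
    \sum_i (\sum_j G i j * r j) * b i <= \sum_j x j * r j - \sum_j r j ^+ 2.
  move=> /var h; rewrite -sumrB -subr_le0; apply: le_trans h.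
  have -> : \sum_i (\sum_j G i j * r j) * b i = \sum_j r j * \sum_i G i j * b i.
    under eq_bigr do rewrite mulr_suml.
    rewrite exchange_big/=; apply: eq_bigr => j _; rewrite mulr_sumr.
    by apply: eq_bigr => i _; ring.
  rewrite -sumrB le_eqVlt; apply/orP; left; apply/eqP; apply: eq_bigr => j _.
  rewrite [in RHS](eq_bigr (fun i => G i j * b i - G i j * a i)) => [|i _]; last exact: mulrBr.
  by rewrite sumrB (_ : \sum_i G i j * a i = x j - r j); [ring|rewrite /r; ring].
have [i xi] := H r.
(* Testing against the vertex s e_i with s the sign of <G_i, r> gives |<G_i, r>| <= <x, r> - |r|^2,
   while <x, r> <= |<G_i, r>| by the choice of i. Hence r = 0. *)
pose s : R := if 0 <= \sum_j G i j * r j then 1 else - 1.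
have := rb (fun k => if k == i then s else 0).
have -> : \sum_k `|if k == i then s else 0| = 1.
  rewrite (bigD1 i)//= eqxx big1 ?addr0; last by move=> k /negbTE ->; rewrite normr0.
  by rewrite /s; case: ifP; rewrite ?normrN normr1.
have -> : \sum_k (\sum_j G k j * r j) * (if k == i then s else 0) = `|\sum_j G i j * r j|.
  rewrite (bigD1 i)//= eqxx [X in _ + X]big1 ?addr0 => [|k /negbTE ->]; last by rewrite mulr0.
  by rewrite /s; case: leP => h; [rewrite mulr1 ger0_norm|rewrite mulrN1 ltr0_norm].
move=> /(_ (lexx 1)) h.
have r0 : \sum_j r j ^+ 2 = 0.
  apply/eqP; rewrite eq_le sumr_ge0 ?andbT => [|j _]; last exact: sqr_ge0.
  by lra.
exists a => // j; apply/eqP; rewrite eq_sym -subr_eq0 -/(r j) -sqrf_eq0.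
have /eqP := r0; rewrite psumr_eq0 => [/allP/(_ j (mem_index_enum j))//|i' _].
exact: sqr_ge0.
Qed.

Lemma countable_measurable_forall d (T : measurableType d) (U : countType)
    (F : U -> set T) : (forall u, measurable (F u)) ->
  measurable [set w | forall u, F u w].
Proof.
move=> mF; rewrite (_ : [set w | _] = \bigcap_(u in [set: U]) F u).
  rewrite -[X in measurable X]setCK setC_bigcap; apply: measurableC.
  by apply: countable_bigcupT_measurable => [|u]; [exact: countableP|exact: measurableC].
by apply/seteqP; split => w h => [u _|u]; exact: h.
Qed.

Lemma exists_rat_near (R : realType) (y e : R) : 0 < e ->
  exists q : rat, `|ratr q - y| <= e.
Proof.
move=> e0; have [|q] := @rat_in_itvoo R (y - e) (y + e); first lra.
by rewrite in_itv/= => /andP[h1 h2]; exists q; rewrite ler_norml; lra.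
Qed.

(** The violating directions are cut out by finitely many strict inequalities continuous in y, so
    they form an open set, which contains a rational point unless empty. This reduces the hull event
    to countably many conditions. *)
Lemma rat_directions (R : realType) (N n : nat) (G : 'I_N -> 'I_n -> R)
    (x : 'I_n -> R) : (0 < N)%N ->
  (forall y : {ffun 'I_n -> rat}, exists i,
     \sum_j x j * ratr (y j) <= `|\sum_j G i j * ratr (y j)|) ->
  forall y : 'I_n -> R, exists i, \sum_j x j * y j <= `|\sum_j G i j * y j|.
Proof.
move=> N0 H y; apply: contrapT => /forallNP nH.
have {}nH i : `|\sum_j G i j * y j| < \sum_j x j * y j by rewrite ltNge; apply/negP.
pose f i := `|\sum_j G i j * y j|.
have [i1 _ fmax] := @arg_maxP _ _ _ (Ordinal N0) xpredT f isT.
pose g := \sum_j x j * y j - f i1.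
have g0 : 0 < g by rewrite subr_gt0; exact: nH.
pose M := \sum_j `|x j| + \sum_i \sum_j `|G i j|.
have M0 : 0 <= M by rewrite addr_ge0// sumr_ge0// => i _; apply: sumr_ge0.
(* The inner products with x and with each row then move by at most g / 4; the + 1 guards against M
   = 0. *)
pose e := g / (4 * (M + 1)).
have e0 : 0 < e by rewrite divr_gt0// mulr_gt0//; lra.
have /choice[q qy] j : exists q : rat, `|ratr q - y j| <= e by exact: exists_rat_near.
have [i xi] := H (finfun q).
have near (z : 'I_n -> R) : \sum_j `|z j| <= M ->
    `|\sum_j z j * ratr (finfun q j) - \sum_j z j * y j| <= e * M.
  move=> zM; rewrite -sumrB; apply: le_trans (ler_norm_sum _ _ _) _.
  apply: le_trans (ler_wpM2l (ltW e0) zM); rewrite mulr_sumr; apply: ler_sum => j _.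
  by rewrite -mulrBr normrM mulrC ler_wpM2r// ffunE.
have eM : e * M <= g / 4.
  rewrite /e mulrAC ler_pdivrMr ?mulr_gt0//; last lra.
  by have := ltW g0; nra.
have hx : `|\sum_j x j * ratr (finfun q j) - \sum_j x j * y j| <= e * M.
  by apply: near; rewrite lerDl sumr_ge0// => i' _; apply: sumr_ge0.
have hG : `|\sum_j G i j * ratr (finfun q j) - \sum_j G i j * y j| <= e * M.
  apply: near; rewrite /M (bigD1 i)//= addrCA lerDl addr_ge0// sumr_ge0// => i' _.
  exact: sumr_ge0.
have := ler_normD (\sum_j G i j * ratr (finfun q j) - \sum_j G i j * y j) (\sum_j G i j * y j).
rewrite subrK => hn.
have hf : `|\sum_j G i j * y j| <= f i1 by exact: fmax.
move: hx; rewrite ler_norml => /andP[hx _].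
rewrite /g in eM g0 *; lra.
Qed.

(** * A single row *)

Section weighted_events.
Context d (T : measurableType d) (R : realType) (P : probability T R).

Let integral_weighted_indic (E : finType) (a : E -> R) (A : E -> set T) :
  (forall e, 0 <= a e) -> (forall e, measurable (A e)) ->
  (\int[P]_w (\sum_e a e * \1_(A e) w)%:E = (\sum_e a e * fine (P (A e)))%:E)%E.
Proof.
move=> a0 mA; under eq_integral => w _ do rewrite -sumEFin.
rewrite ge0_integral_sum//=; last 2 first.
- by move=> e; apply/measurable_EFinP; exact: measurable_funM.
- by move=> e w _; rewrite lee_fin mulr_ge0.
rewrite -sumEFin; apply: eq_bigr => e _.
under eq_integral do rewrite EFinM.
rewrite ge0_integralZl_EFin//; last by apply/measurable_EFinP; exact: measurable_indic.
by rewrite integral_indic// setIT EFinM fineK// fin_num_measure.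
Qed.

(** Integrates a pointwise inequality between simple functions; both averaging arguments for a
    single row take this form. *)
Lemma sum_indic_le (E F : finType) (a : E -> R) (A : E -> set T)
    (c : F -> R) (B : F -> set T) :
  (forall e, 0 <= a e) -> (forall e, measurable (A e)) ->
  (forall f, 0 <= c f) -> (forall f, measurable (B f)) ->
  (forall w, \sum_e a e * \1_(A e) w <= \sum_f c f * \1_(B f) w) ->
  \sum_e a e * fine (P (A e)) <= \sum_f c f * fine (P (B f)).
Proof.
move=> a0 mA c0 mB AB; rewrite -lee_fin -!integral_weighted_indic//.
apply: ge0_le_integral => //.
- by move=> w _; rewrite lee_fin sumr_ge0// => e _; rewrite mulr_ge0.
- apply/measurable_EFinP; apply: measurable_sum => e.
  by apply: measurable_funM => //; exact: measurable_indic.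
- apply/measurable_EFinP; apply: measurable_sum => e.
  by apply: measurable_funM => //; exact: measurable_indic.
- by move=> w _; rewrite lee_fin.
Qed.

End weighted_events.

Section second_moment.
Context d (T : measurableType d) (R : realType) (P : probability T R).

(** By symmetry (X - c)^2 and (- X - c)^2 both integrate to 1, where c is the mean, and their
    half-sum is X^2 + c^2 >= X^2. *)
Lemma symmetric_second_moment (X : {RV P >-> R}) :
  symmetric_rv X -> ('V_P[X] = 1)%E -> (\int[P]_w (X w ^+ 2)%:E <= 1)%E.
Proof.
move=> sX VX; set c := fine 'E_P[X].
have V1 : (\int[P]_w ((X w - c) ^+ 2)%:E = 1)%E.
  rewrite -VX /variance covariance.unlock -/c expectation.unlock; apply: eq_integral => w _.
  by rewrite expr2.
pose g (r : R) : \bar R := ((r - c) ^+ 2)%:E.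
have mg : measurable_fun setT g.
  by apply/measurable_EFinP; apply: measurable_funX; apply: measurable_funB.
have g0 r : (0 <= g r)%E by rewrite lee_fin sqr_ge0.
have mX : measurable_fun [set: T] X by exact: measurable_funPT.
have mNX : measurable_fun [set: T] (\- X) by exact: measurable_funN.
have V2 : (\int[P]_w ((- X w - c) ^+ 2)%:E = 1)%E.
  rewrite -V1.
  have -> : (\int[P]_w ((X w - c) ^+ 2)%:E = \int[pushforward P X]_r g r)%E.
    by rewrite ge0_integral_pushforward.
  have -> : (\int[P]_w ((- X w - c) ^+ 2)%:E = \int[pushforward P (\- X)%R]_r g r)%E.
    by rewrite ge0_integral_pushforward.
  apply: eq_measure_integral => A mA _; exact/esym/sX.
have mq (f : T -> R) : measurable_fun setT f -> measurable_fun setT (fun w => ((f w - c) ^+ 2)%:E).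
  move=> mf; apply/measurable_EFinP; apply: measurable_funX.
  by apply: measurable_funB.
apply: (@le_trans _ _ (\int[P]_w ((2^-1)%:E * (((X w - c) ^+ 2)%:E + ((- X w - c) ^+ 2)%:E)))%E).
  apply: ge0_le_integral => //.
  - by move=> w _; rewrite lee_fin sqr_ge0.
  - by apply/measurable_EFinP; exact: measurable_funX.
  - apply: emeasurable_funM => //; apply: emeasurable_funD; first exact: mq.
    exact: (mq (\- X)).
  - move=> w _; rewrite -EFinD -EFinM lee_fin.
    by have := sqr_ge0 c; nra.
rewrite ge0_integralZl_EFin//; last 2 first.
- by move=> w _; rewrite adde_ge0// lee_fin sqr_ge0.
- by apply: emeasurable_funD; [exact: mq|exact: (mq (\- X))].
rewrite ge0_integralD//; last 4 first.
- by move=> w _; rewrite lee_fin sqr_ge0.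
- exact: mq.
- by move=> w _; rewrite lee_fin sqr_ge0.
- exact: (mq (\- X)).
by rewrite V1 V2 -EFinD -EFinM lee_fin; lra.
Qed.

(** Markov's inequality for the squared norm of the row, whose mean is at most n. *)
Lemma row_norm_tail (n : nat) (X : 'I_n -> {RV P >-> R}) (K : R) :
  (0 < n)%N -> 0 < K -> (forall j, (\int[P]_w (X j w ^+ 2)%:E <= 1)%E) ->
  (P [set w | (n%:R * K < \sum_j X j w ^+ 2)%R] <= (K^-1)%:E)%E.
Proof.
move=> n0 K0 X1; set B := [set w | _].
have n0R : 0 < n%:R :> R by rewrite ltr0n.
have mS : measurable_fun setT (fun w => \sum_j X j w ^+ 2).
  by apply: measurable_sum => j; exact: measurable_funX.
have mB : measurable B.
  rewrite /B -[X in measurable X]setTI.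
  exact: (measurable_fun_ltr (measurable_cst _) mS).
have : (\int[P]_w ((n%:R * K)%:E * (\1_B w)%:E) <= n%:R%:E)%E.
  apply: (@le_trans _ _ (\int[P]_w (\sum_j X j w ^+ 2)%:E)%E).
    apply: ge0_le_integral => //.
    - by move=> w _; rewrite -EFinM lee_fin !mulr_ge0// ltW.
    - by apply: emeasurable_funM => //; apply/measurable_EFinP; exact: measurable_indic.
    - exact/measurable_EFinP.
    - move=> w _; rewrite -EFinM lee_fin indicE.
      case: (boolP (w \in B)) => [/set_mem/ltW wB|_]; first by rewrite mulr1.
      by rewrite mulr0 sumr_ge0// => j _; exact: sqr_ge0.
  under eq_integral do rewrite -sumEFin.
  rewrite ge0_integral_sum//; last 2 first.
  - by move=> j; apply/measurable_EFinP; exact: measurable_funX.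
  - by move=> j w _; rewrite lee_fin sqr_ge0.
  apply: (le_trans (lee_sum _ (fun j _ => X1 j))).
  by rewrite sumEFin lee_fin sumr_const card_ord.
rewrite ge0_integralZl_EFin//; last 2 first.
- by apply/measurable_EFinP; exact: measurable_indic.
- by rewrite mulr_ge0// ltW.
have PBE : P B = (fine (P B))%:E by rewrite fineK// fin_num_measure.
rewrite integral_indic// setIT [X in (_ * X)%E]PBE [X in _ -> (X <= _)%E]PBE.
rewrite -EFinM !lee_fin -mulrA ger_pMr// => h.
by rewrite -[leRHS]mul1r ler_pdivlMr// mulrC.
Qed.

End second_moment.

Section single_row.
Context d (T : measurableType d) (R : realType) (P : probability T R).
Context (I J : finType) (X : I -> J -> {RV P >-> R}).
Hypothesis indep : mutually_independent (fun ij : I * J => X ij.1 ij.2).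
Hypothesis sym : forall i j, symmetric_rv (X i j).
Context (u v : R).
Hypotheses (u0 : 0 < u) (v0 : 0 < v) (v1 : v < 1).
Hypothesis small : forall i j, (P [set w | (`|X i j w| <= u)%R] <= v%:E)%E.
Context (k : nat) (b : J -> 'I_k) (y : J -> R) (i : I).

Let s c := Num.sqrt (\sum_(j | b j == c) y j ^+ 2).
(** These weights add up to s_c on block c, hence to the block norm in total. They linearise it:
    what matters is the weight carried by the entries larger than [u]. *)
Let wt j := y j ^+ 2 / s (b j).
Let large j := [set w | u < `|X i j w|].

Let s0 c : 0 <= s c. Proof. exact: sqrtr_ge0. Qed.

Let sE c : \sum_(j | b j == c) y j ^+ 2 = s c ^+ 2.
Proof. by rewrite sqr_sqrtr// sumr_ge0// => j _; exact: sqr_ge0. Qed.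

Let wt0 j : 0 <= wt j. Proof. by rewrite divr_ge0 ?sqr_ge0. Qed.

Let sum_wt : \sum_j wt j = block_norm b y.
Proof.
rewrite (partition_big b predT)//=; apply: eq_bigr => c _; rewrite -/(s c).
rewrite (eq_bigr (fun j => y j ^+ 2 / s c)) => [|j /eqP <-//].
rewrite -mulr_suml sE; have [->|sn0] := eqVneq (s c) 0; first by rewrite invr0 mulr0.
by rewrite expr2 mulfK.
Qed.

Let mlarge j : measurable (large j).
Proof.
rewrite -[X in measurable X]setTI; apply: measurable_fun_ltr => //.
by apply: measurableT_comp.
Qed.

Let Plarge j : 1 - v <= fine (P (large j)).
Proof.
have -> : large j = ~` [set w | (`|X i j w| <= u)%R].
  by apply/seteqP; split => w /=; rewrite /large/= ltNge => /negP.
have mc : measurable [set w | (`|X i j w| <= u)%R].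
  rewrite -[X in measurable X]setTI; apply: measurable_fun_ler => //.
  by apply: measurableT_comp.
rewrite probability_setC// fineB ?fin_num_measure//= lerD2l lerN2.
by rewrite -lee_fin fineK ?fin_num_measure.
Qed.

Let indicP (A : set T) w : \1_A w = 1 :> R \/ \1_A w = 0 :> R.
Proof. by rewrite indicE; case: (w \in A); [left|right]. Qed.

Let weight w := \sum_j wt j * \1_(large j) w.

Let v2 : 0 <= (1 - v) / 2. Proof. by have := v1; lra. Qed.

Let F := [set w | (1 - v) / 2 * block_norm b y <= weight w].

Let mF : measurable F.
Proof.
rewrite -[X in measurable X]setTI; apply: measurable_fun_ler => //.
by apply: measurable_sum => j; apply: measurable_funM => //; exact: measurable_indic.
Qed.

(** Reverse Markov: [weight] never exceeds the block norm B and has mean at least (1 - v) B, so it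
    reaches half of that with probability at least (1 - v) / 2. *)
Let PF : (1 - v) / 2 <= fine (P F).
Proof.
have [B0|Bn0] := eqVneq (block_norm b y) 0.
  rewrite (_ : F = setT) ?probability_setT /=.
    by have := v0; lra.
  apply/seteqP; split => // w _; rewrite /F/= B0 mulr0 /weight sumr_ge0// => j _.
  by rewrite mulr_ge0.
have Bp : 0 < block_norm b y by rewrite lt_def Bn0 block_norm_ge0.
set B := block_norm b y in Bp *.
have := @sum_indic_le _ _ _ P _ bool wt large
  (fun f => if f then B else (1 - v) / 2 * B) (fun f => if f then F else setT) wt0 mlarge.
rewrite big_bool/= probability_setT/= mulr1 => H.
have {}H : \sum_e wt e * fine (P (large e)) <= B * fine (P F) + (1 - v) / 2 * B.
  apply: H.
  - by case; [exact: ltW|exact: mulr_ge0 v2 (ltW Bp)].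
  - by case.
  - move=> w; rewrite big_bool/= !indicE in_setT/= mulr1 -/(weight w).
    have wB : weight w <= B.
      by rewrite /B -sum_wt; apply: ler_sum => j _; rewrite ler_piMr.
    have [wF|/negP wF] := boolP (w \in F).
      by rewrite mulr1; have := mulr_ge0 v2 (ltW Bp); lra.
    rewrite mulr0 add0r leNgt; apply/negP => h; apply: wF; apply/mem_set; exact: ltW.
have H2 : (1 - v) * B <= \sum_e wt e * fine (P (large e)).
  by rewrite /B -sum_wt mulr_sumr; apply: ler_sum => j _; rewrite mulrC ler_wpM2l.
by rewrite -(ler_pM2l Bp); lra.
Qed.

(** Only the large entries are kept. If A is the sum of their y_j^2 in block c, the block
    contributes at least u sqrt A, and sqrt A >= A / s_c because A <= s_c^2. *)
Let block_norm_row w : u * weight w <= block_norm b (fun j => X i j w * y j).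
Proof.
apply: (@le_trans _ _ (u * block_norm b (fun j => y j * \1_(large j) w))); last first.
  have -> : u * block_norm b (fun j => y j * \1_(large j) w) =
      block_norm b (fun j => u * (y j * \1_(large j) w)) by rewrite block_normZ ?ltW.
  apply: block_norm_mono => j.
  rewrite !normrM (gtr0_norm u0) mulrCA mulrC ler_wpM2r// indicE.
  case: (boolP (w \in _)) => [/set_mem wl|_]; first by rewrite normr1 mulr1 ltW.
  by rewrite normr0 mulr0.
rewrite ler_wpM2l ?(ltW u0)// /weight /block_norm (partition_big b predT)//=; apply: ler_sum => c _.
rewrite -[leLHS]ger0_norm; last by apply: sumr_ge0 => j _; rewrite mulr_ge0.
rewrite -sqrtr_sqr ler_sqrt; last by apply: sumr_ge0 => j _; exact: sqr_ge0.
set A := \sum_(j | b j == c) (y j * \1_(large j) w) ^+ 2.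
have AE : \sum_(j | b j == c) wt j * \1_(large j) w = A / s c.
  rewrite mulr_suml; apply: eq_bigr => j /eqP bj; rewrite /wt bj exprMn.
  by have [->|->] := indicP (large j) w; rewrite ?expr1n ?mulr1// expr0n/= !mulr0 mul0r.
rewrite AE.
have A0 : 0 <= A by apply: sumr_ge0 => j _; exact: sqr_ge0.
have As : A <= s c ^+ 2.
  rewrite -sE; apply: ler_sum => j _; rewrite exprMn ler_piMr ?sqr_ge0//.
have [sc0|sn0] := eqVneq (s c) 0; first by rewrite sc0 invr0 mulr0 expr0n.
have sp : 0 < s c by rewrite lt_def sn0 s0.
rewrite expr_div_n ler_pdivrMr ?exprn_gt0// expr2.
by rewrite ler_wpM2l.
Qed.

(** All sign changes of the row give the event the same probability. On [F], of probability at least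
    (1 - v) / 2, a fraction 1 / (16 * 2^k) of them succeeds; the threshold is the product of u, (1 -
    v) / 2 and 1 / 4. *)
Lemma row_lower_bound :
  (((1 - v) / (32 * 2 ^+ k))%:E <=
  P [set w | (u * (1 - v) / 8 * block_norm b y <= `|\sum_j X i j w * y j|)%R])%E.
Proof.
set tau := u * (1 - v) / 8 * block_norm b y.
pose B : set (coord_space R J) := [set x | tau <= `|\sum_j x j * y j|].
have mB : measurable B.
  rewrite -[X in measurable X]setTI; apply: measurable_fun_ler => //.
  apply: measurableT_comp => //; apply: measurable_sum => j.
  by apply: measurable_funM => //; exact: measurable_coord.
pose E (e : {ffun J -> bool}) := [set w | B (fun j => (-1) ^+ e j * X i j w)].
have PE e : P (E e) = P [set w | B (fun j => X i j w)] by exact: sign_invariant_row.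
have mE e : measurable (E e).
  rewrite /E -[X in measurable X]setTI.
  apply: (@measurable_to_coord_space R J _ _ (fun j w => (-1) ^+ e j * X i j w) _ measurableT B mB).
  by move=> j; exact: measurable_funM.
set p := P _; rewrite -(@fineK _ p) ?fin_num_measure//; last first.
  by rewrite -[X in measurable X]setTI; apply: (@measurable_to_coord_space R J _ _ (X i) _ measurableT B mB).
rewrite lee_fin; set m : R := #|{ffun J -> bool}|%:R.
have m0 : 0 < m by rewrite ltr0n card_ffun expn_gt0 card_bool.
have := @sum_indic_le _ _ _ P 'I_1 _ (fun=> m / (16 * 2 ^+ k)) (fun=> F) (fun=> 1) E.
have -> : \sum_e 1 * fine (P (E e)) = m * fine p.
  rewrite (eq_bigr (fun=> fine p)) => [|e _]; last by rewrite mul1r PE.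
  by rewrite sumr_const mulr_natl.
rewrite big_ord1 => H.
have {}H : m / (16 * 2 ^+ k) * fine (P F) <= m * fine p.
  apply: H => //; first by move=> _; rewrite divr_ge0 ?mulr_ge0// ltW.
  move=> w; rewrite big_ord1.
  under eq_bigr do rewrite mul1r.
  rewrite [in leLHS]indicE; case: (boolP (w \in F)) => [/set_mem wF|_]; last first.
    by rewrite mulr0 sumr_ge0.
  rewrite mulr1 ler_pdivrMr ?mulr_gt0 ?exprn_gt0// mulrC.
  apply: le_trans (card_signed_sum_ge b (fun j => X i j w * y j)) _.
  rewrite ler_wpM2l ?mulr_ge0 ?exprn_ge0//.
  rewrite -sum1_card natr_sum big_mkcond/=; apply: ler_sum => e _.
  rewrite indicE; case: ifPn => // eG; rewrite (_ : (w \in E e) = true)//.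
  apply/mem_set; rewrite /E/= /B/=.
  apply: le_trans (ler_norm _).
  move: eG; rewrite inE => eG; apply: (@le_trans _ _ (block_norm b (fun j => X i j w * y j) / 4)).
    rewrite /tau ler_pdivlMr//; apply: le_trans (block_norm_row w).
    have := ler_wpM2l (ltW u0) wF; rewrite /F/=; lra.
  apply: le_trans eG _; rewrite le_eqVlt; apply/orP; left; apply/eqP.
  by apply: eq_bigr => j _; rewrite mulrA.
have h : m / (16 * 2 ^+ k) * ((1 - v) / 2) <= m * fine p.
  apply: le_trans H; apply: ler_wpM2l; last exact: PF.
  by rewrite divr_ge0 ?mulr_ge0 ?exprn_ge0// (ltW m0).
rewrite -(ler_pM2l m0); apply: le_trans h; rewrite le_eqVlt; apply/orP; left.
by apply/eqP; field; rewrite expf_neq0.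
Qed.

End single_row.

(** * All directions simultaneously *)

(* A direction y of block norm 1 is rounded to a lattice point y0; were all
   |<G_i, y>| < t / 4, the more than N p / 4 rows witnessing y0 would each give
   |<G_i, y - y0>| >= t / 4, against the l2-bound on the rounding error. *)
Lemma lattice_to_all_directions (R : realType) (N n k : nat)
    (G : 'I_N -> 'I_n -> R) (p t : R) :
  let delta := p * t / 8 in let eta := delta / Num.sqrt n%:R in
  (0 < N)%N -> (0 < n)%N -> 0 < p -> 0 < t -> k%:R * delta <= 1 / 2 ->
  (forall z : 'I_n -> int,
     \sum_j `|(z j)%:~R| <= n%:R * (delta^-1 + 1) :> R ->
     (exists b : 'I_n -> 'I_k, 1 / 2 <= block_norm b (fun j => eta * (z j)%:~R)) ->
     N%:R * p / 4 < #|[pred i | (t / 2 <= `|\sum_j G i j * (eta * (z j)%:~R)|) &&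
                               (\sum_j G i j ^+ 2 <= n%:R * p^-1)]|%:R) ->
  forall (b : 'I_n -> 'I_k) (y : 'I_n -> R),
    exists i, t / 4 * block_norm b y <= `|\sum_j G i j * y j|.
Proof.
move=> delta eta N0 n0 p0 t0 kd H b y'.
have [B0|Bn0] := eqVneq (block_norm b y') 0.
  by exists (Ordinal N0); rewrite B0 mulr0.
have B0 : 0 < block_norm b y' by rewrite lt_def Bn0 block_norm_ge0.
pose y j := (block_norm b y')^-1 * y' j.
have y1 : block_norm b y = 1 by rewrite block_normZ ?invr_ge0 ?ltW// mulVf.
have yE i : \sum_j G i j * y j = (block_norm b y')^-1 * \sum_j G i j * y' j.
  by rewrite mulr_sumr; apply: eq_bigr => j _; rewrite mulrCA.
suff [i Hi] : exists i, t / 4 <= `|\sum_j G i j * y j|.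
  by exists i; move: Hi; rewrite yE normrM gtr0_norm ?invr_gt0// [leRHS]mulrC ler_pdivlMr.
apply: contrapT => /forallNP nH.
have {}nH i : `|\sum_j G i j * y j| < t / 4 by rewrite ltNge; apply/negP.
have n0R : 0 < n%:R :> R by rewrite ltr0n.
set rn := Num.sqrt n%:R in eta H.
have rn0 : 0 < rn by rewrite sqrtr_gt0.
have rn2 : rn ^+ 2 = n%:R by rewrite sqr_sqrtr// ltW.
have d0 : 0 < delta by rewrite divr_gt0// mulr_gt0.
have e0 : 0 < eta by rewrite divr_gt0.
have eta2 : n%:R * eta ^+ 2 = delta ^+ 2.
  by rewrite /eta expr_div_n rn2 mulrCA divff ?mulr1// gt_eqF.
(* Rows of large norm are replaced by 0, so the Hilbert-Schmidt norm is controlled while the rows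
   counted in the hypothesis are untouched. *)
pose g i j := if \sum_j G i j ^+ 2 <= n%:R * p^-1 then G i j else 0.
have [z [z1 z2]] := rounding g y e0.
pose d j := y j - eta * (z j)%:~R.
have y2 : \sum_j y j ^+ 2 <= 1 by have := sum_sq_le_block_norm b y; rewrite y1 expr1n.
(* By Cauchy-Schwarz |y|_1 <= sqrt n. Dividing by eta gives n / delta, and rounding adds at most 1
   per coordinate. *)
have zl1 : \sum_j `|(z j)%:~R| <= n%:R * (delta^-1 + 1) :> R.
  have ysum : \sum_j `|y j| <= rn.
    have := sum_sq_CS xpredT (fun j => `|y j|) (fun=> 1).
    under eq_bigr do rewrite mulr1.
    move=> h; apply: le_trans h _.
    rewrite sumr_const card_ord expr1n -/rn ler_piMl ?(ltW rn0)//.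
    rewrite -[leRHS]sqrtr1 ler_sqrt//; apply: le_trans y2.
    by apply: ler_sum => j _; rewrite real_normK ?num_real.
  have zj j : `|(z j)%:~R| <= eta^-1 * `|y j| + 1 :> R.
    rewrite -(ler_pM2l e0) mulrDr mulVKf ?gt_eqF// mulr1.
    rewrite -{1}(gtr0_norm e0) -normrM.
    have -> : eta * (z j)%:~R = y j - d j by rewrite /d; ring.
    by apply: le_trans (ler_normB _ _) _; rewrite lerD2l; exact: z1.
  apply: le_trans (ler_sum _ (fun j _ => zj j)) _.
  rewrite big_split/= -mulr_sumr sumr_const card_ord mulrDr mulr1 lerD2r.
  apply: (@le_trans _ _ (eta^-1 * rn)); first by rewrite ler_wpM2l ?invr_ge0 ?(ltW e0).
  by rewrite /eta invf_div mulrAC -expr2 rn2.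
(* The rounding error has l2-norm at most eta sqrt n = delta, hence block norm at most k delta <= 1
   / 2. *)
have zb : 1 / 2 <= block_norm b (fun j => eta * (z j)%:~R).
  have hd : block_norm b d <= 1 / 2.
    apply: le_trans (block_norm_le _ _) _; apply: le_trans kd.
    rewrite ler_wpM2l// -[leRHS]gtr0_norm// -sqrtr_sqr ler_sqrt ?sqr_ge0// -eta2.
    apply: (@le_trans _ _ (\sum_(j < n) eta ^+ 2)).
      apply: ler_sum => j _; rewrite -[leLHS]real_normK ?num_real//.
      by rewrite lerXn2r ?nnegrE ?(ltW e0)//; exact: z1.
    by rewrite sumr_const card_ord mulr_natl.
  have := block_normD b (fun j => eta * (z j)%:~R) d.
  have -> : block_norm b (fun j => eta * (z j)%:~R + d j) = 1.
    by rewrite -[RHS]y1; congr block_norm; apply/funext => j; rewrite /d; ring.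
  lra.
have := H z zl1 (ex_intro _ b zb); set S := [pred i | _] => HS.
have gd i : i \in S -> (t / 4) ^+ 2 <= (\sum_j g i j * d j) ^+ 2.
  rewrite inE => /andP[h1 h2]; rewrite /g h2 -[leRHS]real_normK ?num_real//.
  rewrite lerXn2r ?nnegrE ?divr_ge0 ?(ltW t0)//.
  have -> : \sum_j G i j * d j = \sum_j G i j * y j - \sum_j G i j * (eta * (z j)%:~R).
    by rewrite -sumrB; apply: eq_bigr => j _; rewrite /d mulrBr.
  have := nH i; rewrite distrC.
  have := lerB_dist (\sum_j G i j * (eta * (z j)%:~R)) (\sum_j G i j * y j).
  lra.
have h1 : #|S|%:R * (t / 4) ^+ 2 <= \sum_i (\sum_j g i j * d j) ^+ 2.
  rewrite mulr_natl -sumr_const big_mkcond/=; apply: ler_sum => i _.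
  by case: ifPn => [/gd//|_]; exact: sqr_ge0.
have h2 : \sum_i \sum_j g i j ^+ 2 <= N%:R * (n%:R * p^-1).
  rewrite -[in leRHS](card_ord N) mulr_natl -sumr_const; apply: ler_sum => i _.
  rewrite /g; case: (boolP (\sum_j G i j ^+ 2 <= n%:R * p^-1)) => // _.
  rewrite big1 ?mulr_ge0 ?invr_ge0 ?(ltW p0)// => j _.
  by rewrite expr0n.
have h3 : #|S|%:R * (t / 4) ^+ 2 <= eta ^+ 2 * (N%:R * (n%:R * p^-1)).
  by apply: le_trans h1 (le_trans z2 _); rewrite ler_wpM2l ?sqr_ge0.
(* The value delta = p t / 8 is tuned for this equality: the rounding bound is exactly what N p / 4
   witnessing rows would need, and there are strictly more. *)
have h4 : eta ^+ 2 * (N%:R * (n%:R * p^-1)) = N%:R * p / 4 * (t / 4) ^+ 2.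
  rewrite (_ : eta ^+ 2 * _ = (n%:R * eta ^+ 2) * (N%:R * p^-1)); last by ring.
  by rewrite eta2 /delta; field; rewrite gt_eqF.
have t4 : 0 < (t / 4) ^+ 2 by rewrite exprn_gt0// divr_gt0.
by move: h3; rewrite h4 ler_pM2r// leNgt HS.
Qed.

(** Distributing the x_j^2 evenly leaves at most L / k + 1 <= kappa + 1 in each block, so <x, y> <=
    sqrt (kappa + 1) |y|_b for a block map that depends on x but not on y. Separation concludes. *)
Lemma dilate_sub_hull (R : realType) (N n k : nat) (G : 'I_N -> 'I_n -> R)
    (t L kappa C : R) :
  (0 < k)%N -> 0 <= L -> 0 < kappa -> L <= kappa * k%:R ->
  0 <= C -> C * Num.sqrt (kappa + 1) <= t ->
  (forall (b : 'I_n -> 'I_k) (y : 'I_n -> R),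
    exists i, t * block_norm b y <= `|\sum_j G i j * y j|) ->
  forall x : 'I_n -> R, (forall j, `|x j| <= 1) -> \sum_j x j ^+ 2 <= L ->
  exists2 a : 'I_N -> R, \sum_i `|a i| <= 1 & forall j, \sum_i G i j * a i = C * x j.
Proof.
move=> k0 L0 kappa0 Lk C0 Ct H x x1 x2; apply: mem_absconv_hull => y.
have k0R : 0 < k%:R :> R by rewrite ltr0n.
have [|b Hb] := @balanced_blocks R 'I_n k (fun j => x j ^+ 2) L k0 _ x2.
  by move=> j; rewrite sqr_ge0/= -[leLHS]real_normK ?num_real// expr_le1.
have [i Hi] := H b y; exists i; apply: le_trans Hi.
under eq_bigr do rewrite -mulrA.
rewrite -mulr_sumr; apply: (@le_trans _ _ (C * (Num.sqrt (kappa + 1) * block_norm b y))).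
  rewrite ler_wpM2l//; apply: pairing_le_block_norm => c.
  by apply: le_trans (Hb c) _; rewrite lerD2r ler_pdivrMr.
by rewrite mulrA ler_wpM2r// block_norm_ge0.
Qed.

(** By duality the event says that for each rational y some |<X_i, y>| bounds <x, y> for all x in
    [S]. The upper bounds form an up-closed set of reals, an interval, whatever [S] is. *)
Lemma measurable_hull_event d (T : measurableType d) (R : realType)
    (N n : nat) (X : 'I_N -> 'I_n -> T -> R) (S : set ('I_n -> R)) :
  (0 < N)%N -> (forall i j, measurable_fun [set: T] (X i j)) ->
  measurable [set w | forall x, S x -> exists2 a : 'I_N -> R,
    \sum_i `|a i| <= 1 & forall j, \sum_i X i j w * a i = x j].
Proof.
move=> N0 mX.
pose f (y : {ffun 'I_n -> rat}) i w := `|\sum_j X i j w * ratr (y j)|.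
pose U (y : {ffun 'I_n -> rat}) : set R :=
  [set r | forall x, S x -> \sum_j x j * ratr (y j) <= r].
have mU y : measurable (U y).
  by apply: is_interval_measurable => r1 r2 U1 _ r /andP[r1r _] x /U1 /le_trans; exact.
have mf y i : measurable_fun setT (f y i).
  apply: measurableT_comp => //; apply: measurable_sum => j.
  exact: measurable_funM.
rewrite (_ : [set w | _] = [set w | forall y, (\bigcup_(i in [set: 'I_N]) (f y i @^-1` U y)) w]).
  apply: countable_measurable_forall => y.
  apply: fin_bigcup_measurable => [|i _]; first exact: finite_finset.
  by rewrite -[X in measurable X]setTI; exact: mf.
apply/seteqP; split => w /= H.
  move=> y.
  (* The row maximising |<X_i, y>| serves all x in [S] at once, as <x, y> is at most the sum of the
     |a_i| |<X_i, y>|. *)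
  have [i1 _ fmax] := @arg_maxP _ _ _ (Ordinal N0) xpredT (f y ^~ w) isT.
  exists i1 => // x /H [a a1 ax].
  under eq_bigr do rewrite -ax mulr_suml.
  rewrite exchange_big/=; apply: (@le_trans _ _ (\sum_i `|a i| * f y i1 w)).
    apply: ler_sum => i _.
    have -> : \sum_j X i j w * a i * ratr (y j) = a i * \sum_j X i j w * ratr (y j).
      by rewrite mulr_sumr; apply: eq_bigr => j _; ring.
    apply: le_trans (ler_norm _) _; rewrite normrM ler_wpM2l//; exact: fmax.
  by rewrite -mulr_suml ler_piMl// normr_ge0.
move=> x Sx; apply: mem_absconv_hull; apply: rat_directions => // y.
by have [i _ Hi] := H y; exists i; exact: Hi.
Qed.

(** * Union bound over the lattice net *)

Section net_event.
Context d (T : measurableType d) (R : realType) (P : probability T R).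
Context (N n k : nat) (X : 'I_N -> 'I_n -> {RV P >-> R}).
Hypothesis indep : mutually_independent (fun ij : 'I_N * 'I_n => X ij.1 ij.2).
Hypothesis sym : forall i j, symmetric_rv (X i j).
Hypothesis var1 : forall i j, ('V_P[X i j] = 1)%E.
Context (u v : R).
Hypotheses (u0 : 0 < u) (v0 : 0 < v) (v1 : v < 1).
Hypothesis small : forall i j, (P [set w | (`|X i j w| <= u)%R] <= v%:E)%E.
Hypotheses (N0 : (0 < N)%N) (n0 : (0 < n)%N).

(** Half the probability given by [row_lower_bound]. The other half pays for rows of squared norm
    above n / p, which by Markov have probability at most p. *)
Let p := (1 - v) / (64 * 2 ^+ k).
Let t := u * (1 - v) / 8.
Let delta := p * t / 8.

Let p0 : 0 < p.
Proof. by rewrite divr_gt0 ?mulr_gt0 ?exprn_gt0// subr_gt0. Qed.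

Let t0 : 0 < t.
Proof. by rewrite divr_gt0 ?mulr_gt0// subr_gt0. Qed.

Let good (y : 'I_n -> R) (x : 'I_n -> R) :=
  (t / 2 <= `|\sum_j x j * y j|) && (\sum_j x j ^+ 2 <= n%:R * p^-1).

Let mgood y : measurable ([set x | good y x] : set (coord_space R 'I_n)).
Proof.
rewrite (_ : [set x | _] = [set x | t / 2 <= `|\sum_j x j * y j|] `&`
   [set x | \sum_j x j ^+ 2 <= n%:R * p^-1]); last first.
  by apply/seteqP; split => x /= /andP.
apply: measurableI; rewrite -[X in measurable X]setTI.
  apply: measurable_fun_ler => //; apply: measurableT_comp => //.
  by apply: measurable_sum => j; apply: measurable_funM => //; exact: measurable_coord.
apply: measurable_fun_ler => //; apply: measurable_sum => j.
by apply: measurable_funX; exact: measurable_coord.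
Qed.

Let measurable_row i B : measurable (B : set (coord_space R 'I_n)) ->
  measurable [set w | B (fun j => X i j w)].
Proof.
by move=> mB; rewrite -[X in measurable X]setTI; apply: (@measurable_to_coord_space R _ _ _ (X i) _ measurableT B mB).
Qed.

Let good_row_ge (y : 'I_n -> R) i : (exists b : 'I_n -> 'I_k, 1 / 2 <= block_norm b y) ->
  (p%:E <= P [set w | good y (fun j => X i j w)])%E.
Proof.
move=> [b yb]; set G := [set w | _].
have mG : measurable G by exact: (measurable_row i (mgood y)).
pose A := [set w | t * block_norm b y <= `|\sum_j X i j w * y j|].
pose B := [set w | n%:R * p^-1 < \sum_j X i j w ^+ 2].
have mA : measurable A.
  rewrite -[X in measurable X]setTI; apply: measurable_fun_ler => //.
  by apply: measurableT_comp => //; apply: measurable_sum => j; exact: measurable_funM.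
have mB : measurable B.
  rewrite -[X in measurable X]setTI; apply: measurable_fun_ltr => //.
  by apply: measurable_sum => j; exact: measurable_funX.
have PB : (P B <= p%:E)%E.
  rewrite -[p]invrK; apply: row_norm_tail; rewrite ?invr_gt0// => j.
  exact: symmetric_second_moment.
have PA : ((p + p)%:E <= P A)%E.
  rewrite (_ : p + p = (1 - v) / (32 * 2 ^+ k)); first exact: row_lower_bound.
  by rewrite /p; field; rewrite expf_neq0.
have AGB : A `<=` G `|` B.
  move=> w Aw; have [h|h] := leP (\sum_j X i j w ^+ 2) (n%:R * p^-1); last by right.
  left; rewrite /G/= /good h andbT; apply: le_trans Aw.
  by rewrite ler_wpM2l ?(ltW t0)//; lra.
have : ((p + p)%:E <= P G + p%:E)%E.
  apply: le_trans PA _; apply: le_trans (leeD2l _ PB).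
  apply: le_trans (measureU2 _ mG mB).
  by apply: le_measure; rewrite ?inE//; exact: measurableU.
by rewrite EFinD leeD2rE.
Qed.

Let few_good_rows (y : 'I_n -> R) : (exists b : 'I_n -> 'I_k, 1 / 2 <= block_norm b y) ->
  (P [set w | (#|[pred i | good y (fun j => X i j w)]|%:R <= N%:R * p / 4)%R] <=
   (expR (- (N%:R * p / 4)))%:E)%E.
Proof.
move=> yb; have := @chernoff_count _ _ _ P 'I_N (fun i => [set w | good y (fun j => X i j w)]) p.
rewrite card_ord => H.
rewrite (_ : [set w | _] = [set w | (#|[pred i | `[< [set w | good y (fun j => X i j w)] w >]]|%:R <= N%:R * p / 4)%R]).
  apply: H => [i|e|i]; [exact: (measurable_row i (mgood y))| |exact: good_row_ge].
  (* The atoms required by Chernoff's bound are row events, each row being confined to the good set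
     or to its complement. *)
  pose B i : set (coord_space R 'I_n) := if e i then [set x | good y x] else ~` [set x | good y x].
  have mB i : measurable (B i) by rewrite /B; case: (e i) => //; exact: measurableC.
  have BE i w : B i (fun j => X i j w) = (if e i then [set w | good y (fun j => X i j w)]
      else ~` [set w | good y (fun j => X i j w)]) w by rewrite /B; case: (e i).
  have := independent_rows indep mB.
  rewrite (_ : [set w | _] = [set w | forall i, (if e i then [set w | good y (fun j => X i j w)]
      else ~` [set w | good y (fun j => X i j w)]) w]); last first.
    by apply/seteqP; split => w /= h i; have := h i; rewrite BE.
  move=> ->; apply: eq_bigr => i _; congr (P _); apply/seteqP; split => w /=;
    by rewrite BE.
apply/seteqP; split => w /=; rewrite (_ : #|_| = #|[pred i | good y (fun j => X i j w)]|)//;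
  by apply: eq_card => i; rewrite !inE asboolb.
Qed.

(** Sign and bounded magnitude make the net a finite type, in the form counted by [card_l1_ball];
    zero has two codes, which only enlarges the count. *)
Let lattice (m : nat) (f : {ffun 'I_n -> bool * 'I_m}) (j : 'I_n) : int :=
  (-1) ^+ (f j).1 * (f j).2%:Z.

Let lattice_surj (r : R) (z : 'I_n -> int) : 0 <= r -> \sum_j `|(z j)%:~R| <= r ->
  exists2 f : {ffun 'I_n -> bool * 'I_(Num.truncn r).+1},
    (\sum_j (f j).2)%N%:R <= r & lattice f =1 z.
Proof.
move=> r0 zr.
have zE j : `|(z j)%:~R| = `|z j|%N%:R :> R by rewrite -intr_norm -abszE pmulrn.
have zlt j : (`|z j|%N < (Num.truncn r).+1)%N.
  rewrite ltnS -(ler_nat R).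
  have : `|z j|%N%:R <= r.
    rewrite -zE; apply: le_trans zr; rewrite (bigD1 j)//= lerDl.
    by apply: sumr_ge0.
  by rewrite -truncn_ge_nat// ler_nat.
exists [ffun j => (z j < 0, Ordinal (zlt j))].
  apply: le_trans zr; rewrite natr_sum; apply: ler_sum => j _.
  by rewrite ffunE/= zE.
by move=> j; rewrite /lattice ffunE/= abszE -realEsign ?num_real.
Qed.

Let eta := delta / Num.sqrt n%:R.

Let radius := n%:R * (delta^-1 + 1).

Let m := (Num.truncn radius).+1.

(** The block map is quantified inside the condition, so the union bound runs over lattice points
    only and not over the k^n block maps. *)
Let admissible := [pred f : {ffun 'I_n -> bool * 'I_m} |
  ((\sum_j (f j).2)%N%:R <= radius) &&
  `[< exists b : 'I_n -> 'I_k, 1 / 2 <= block_norm b (fun j => eta * (lattice f j)%:~R) >]].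

Let failure : set T := [set w | exists2 f, admissible f &
  [set w | (#|[pred i | good (fun j => eta * (lattice f j)%:~R) (fun j => X i j w)]|%:R
    <= N%:R * p / 4)%R] w].

Let mfew y : measurable [set w | (#|[pred i | good y (fun j => X i j w)]|%:R <= N%:R * p / 4)%R].
Proof.
rewrite -[X in measurable X]setTI; apply: measurable_fun_ler => //.
rewrite (_ : (fun w => _) = (fun w => \sum_(i < N) \1_[set w | good y (fun j => X i j w)] w)).
  by apply: measurable_sum => i; apply: measurable_indic; exact: (measurable_row i (mgood y)).
apply/funext => w; rewrite -sum1_card natr_sum big_mkcond/=; apply: eq_bigr => i _.
rewrite inE/= indicE; case: (boolP (good _ _)) => h.
  by rewrite mem_set.
by rewrite memNset// => /=; apply/negP.
Qed.

Let delta0 : 0 < delta.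
Proof. by rewrite divr_gt0// mulr_gt0. Qed.

Let failure_le :
  (P failure <= ((2 * expR 1 * (1 + (delta^-1 + 1))) ^+ n * expR (- (N%:R * p / 4)))%:E)%E.
Proof.
apply: (le_trans (measure_exists_le _ _ _)) => [f|]; first exact: mfew.
apply: (@le_trans _ _ (\sum_(f | admissible f) (expR (- (N%:R * p / 4)))%:E)%E).
  by apply: lee_sum => f /andP[_ /asboolP]; exact: few_good_rows.
rewrite sumEFin lee_fin sumr_const -[leLHS]mulr_natl ler_wpM2r ?expR_ge0//.
have r0 : 0 < delta^-1 + 1 by rewrite addr_gt0// invr_gt0.
have := @card_l1_ball R 'I_n m _ r0; rewrite card_ord; apply: le_trans.
by rewrite ler_nat; apply: subset_leq_card; apply/fintype.subsetP => f /andP[].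
Qed.

Let mfailure : measurable failure.
Proof.
rewrite (_ : failure = \bigcup_(f in [set f | admissible f])
  [set w | (#|[pred i | good (fun j => eta * (lattice f j)%:~R) (fun j => X i j w)]|%:R
    <= N%:R * p / 4)%R]) //.
by apply: fin_bigcup_measurable => [|f _]; [exact: finite_finset|exact: mfew].
Qed.

Lemma all_directions_event (E : set T) : measurable E -> k%:R * delta <= 1 / 2 ->
  (forall w, (forall (b : 'I_n -> 'I_k) (y : 'I_n -> R), exists i,
     t / 4 * block_norm b y <= `|\sum_j X i j w * y j|) -> E w) ->
  ((1 - (2 * expR 1 * (1 + (delta^-1 + 1))) ^+ n * expR (- (N%:R * p / 4)))%:E <= P E)%E.
Proof.
move=> mE kd HE.
have fE : ~` failure `<=` E.
  move=> w nf; apply: HE.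
  apply: (@lattice_to_all_directions R N n k (fun i j => X i j w) p t) => // z zr zb.
  have [|f fr fz] := @lattice_surj radius z _ zr.
    by rewrite mulr_ge0// addr_ge0// invr_ge0 ltW.
  have fE : (fun j => eta * (lattice f j)%:~R) = (fun j => eta * (z j)%:~R) :> ('I_n -> R).
    by apply/funext => j; rewrite fz.
  rewrite ltNge; apply/negP => h; apply: nf; exists f.
    by rewrite /admissible/= fr/=; apply/asboolP; rewrite fE.
  by rewrite /= fE.
apply: (@le_trans _ _ (P (~` failure))).
  rewrite probability_setC// EFinB; apply: leeB => //; exact: failure_le.
by apply: le_measure; rewrite ?inE//; exact: measurableC.
Qed.

End net_event.

(** * Constants *)

(** With k close to (beta / 2) ln q, p is at least of order q^(- beta / 2), so q p is at least of
    order q^(1 - beta / 2). This beats q^(1 - beta) by a power of q, and beats ln (1 / delta), which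
    is of order ln q. *)
Lemma parameter_choice (R : realType) (u v beta : R) : 0 < u < 1 -> 0 < v < 1 -> 0 < beta < 1 ->
  exists2 M : R, 1 <= M & forall q : R, M <= q ->
  let k := (Num.truncn (beta / 2 * ln q)).+1 in
  let p := (1 - v) / (64 * 2 ^+ k) in
  let delta := p * (u * (1 - v) / 8) / 8 in
  ln (2 * expR 1 * (1 + (delta^-1 + 1))) <= q * p / 8 /\ q `^ (1 - beta) <= q * p / 8.
Proof.
move=> /andP[u0 u1] /andP[v0 v1] /andP[b0 b1].
pose c1 := (1 - v) / 128; have c10 : 0 < c1 by rewrite /c1; lra.
pose D := 64 / (c1 * (u * (1 - v))).
have v10 : 0 < 1 - v by lra.
have uv0 : 0 < u * (1 - v) by rewrite mulr_gt0//; lra.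
have D0 : 0 < D by rewrite divr_gt0// mulr_gt0.
pose a := 2 * expR 1 * (2 + D).
have a0 : 0 < a by rewrite !mulr_gt0 ?expR_gt0//; lra.
(* From [s1] on, c1 q^(beta / 2) >= 8, which gives the power bound; from [s2] on, q^(1/4) absorbs
   the constants of the logarithmic bound. *)
pose s1 := ln (8 / c1) / (beta / 2).
pose s2 := 4 * ln (8 * (a + 4) / c1).
exists (1 + expR s1 + expR s2).
  by have := expR_ge0 s1; have := expR_ge0 s2; lra.
move=> q Mq k p delta.
have q1 : 1 <= q by have := expR_ge0 s1; have := expR_ge0 s2; lra.
have q0 : 0 < q by lra.
pose s := ln q; have qE : q = expR s by rewrite lnK.
have s0 : 0 <= s by rewrite ln_ge0.
have ss1 : s1 <= s by rewrite -ler_expR -qE; have := expR_ge0 s2; lra.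
have ss2 : s2 <= s by rewrite -ler_expR -qE; have := expR_ge0 s1; lra.
have k2 : 2 ^+ k <= 2 * expR (beta / 2 * s).
  rewrite /k exprS ler_wpM2l//.
  set j := Num.truncn _.
  have js : j%:R <= beta / 2 * s.
    by have := @truncn_itv R (beta / 2 * s); rewrite mulr_ge0 ?divr_ge0 ?(ltW b0)// => /(_ isT)/andP[].
  apply: (@le_trans _ _ (expR 1 ^+ j)).
    by rewrite lerXn2r ?nnegrE ?expR_ge0//; apply: le_trans (expR_ge1Dx _).
  by rewrite -expRM_natl mulr1 ler_expR.
have k20 : 0 < 2 ^+ k :> R by rewrite exprn_gt0.
have pc : c1 * expR (- (beta / 2 * s)) <= p.
  have e0 := expR_gt0 (beta / 2 * s).
  rewrite /p /c1 expRN; move: k2 k20 e0 v10.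
  set e := expR _; set K := 2 ^+ k; set w := 1 - v => k2 K0 e0 w0.
  rewrite ler_pdivlMr ?mulr_gt0// -subr_ge0.
  rewrite (_ : _ - _ = w / e * (e - K / 2)); last by field; rewrite gt_eqF.
  by rewrite mulr_ge0 ?divr_ge0 ?(ltW w0) ?(ltW e0)//; lra.
have p0 : 0 < p by rewrite /p divr_gt0 ?mulr_gt0// subr_gt0.
clearbody k p c1.
have qp : c1 / 8 * expR ((1 - beta / 2) * s) <= q * p / 8.
  rewrite (_ : (1 - beta / 2) * s = s + - (beta / 2 * s)); last by ring.
  rewrite expRD -qE.
  have := ler_wpM2l (ltW q0) pc; lra.
have h2 : q `^ (1 - beta) <= q * p / 8.
  apply: le_trans qp; rewrite /powR gt_eqF// -/s.
  rewrite (_ : (1 - beta / 2) * s = (1 - beta) * s + beta / 2 * s); last by field.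
  rewrite expRD mulrCA ler_peMr ?expR_ge0//.
  have : 8 / c1 <= expR (beta / 2 * s).
    rewrite (_ : 8 / c1 = expR (ln (8 / c1))) ?ler_expR; last by rewrite lnK// posrE divr_gt0.
    by move: ss1; rewrite /s1 ler_pdivrMr ?divr_gt0// [leRHS]mulrC.
  by rewrite ler_pdivrMr//; lra.
split => //.
have d0 : 0 < delta by rewrite /delta !divr_gt0// !mulr_gt0// divr_gt0.
have dD : delta^-1 <= D * expR (beta / 2 * s).
  have DE0 : 0 < D * expR (beta / 2 * s) by rewrite mulr_gt0// expR_gt0.
  rewrite -[leRHS]invrK lef_pV2 ?posrE ?invr_gt0//.
  rewrite invfM /D invf_div -expRN /delta (_ : p * _ / 8 = p * (u * (1 - v) / 64)); last by field.
  have uv64 : 0 <= u * (1 - v) / 64 by rewrite divr_ge0 ?(ltW uv0).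
  by have := ler_wpM2r uv64 pc; lra.
have e1 : 1 <= expR (beta / 2 * s) by rewrite -expR0 ler_expR mulr_ge0// divr_ge0// ltW.
have h1 : 2 * expR 1 * (1 + (delta^-1 + 1)) <= a * expR (beta / 2 * s).
  rewrite /a -[leRHS]mulrA ler_wpM2l ?mulr_ge0 ?expR_ge0//.
  by rewrite mulrDl; have := dD; lra.
have lhs0 : 0 < 2 * expR 1 * (1 + (delta^-1 + 1)).
  by rewrite !mulr_gt0 ?expR_gt0//; have := invr_gt0 delta; rewrite d0 => h; lra.
clearbody a delta D.
have h3 : ln (2 * expR 1 * (1 + (delta^-1 + 1))) <= a + s.
  apply: (@le_trans _ _ (ln (a * expR (beta / 2 * s)))).
    by rewrite ler_ln ?posrE// mulr_gt0// expR_gt0.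
  rewrite lnM ?posrE ?expR_gt0// expRK.
  have : ln a <= a by have := expR_ge1Dx (ln a); rewrite lnK ?posrE//; lra.
  have : 0 <= (1 - beta / 2) * s by rewrite mulr_ge0//; lra.
  lra.
apply: le_trans h3 _; apply: le_trans qp.
(* With x = q^(1/4), a + s <= (a + 4) x <= c1 / 8 * x^2, and x^2 = q^(1/2) <= q^(1 - beta / 2) as
   beta < 1. *)
pose x := expR (s / 4).
have x1 : 1 <= x by rewrite -expR0 ler_expR divr_ge0.
have sx : s <= 4 * x.
  have := expR_ge1Dx (s / 4); rewrite -/x; lra.
have xx : x * x <= expR ((1 - beta / 2) * s).
  rewrite -expRD ler_expR.
  have : 0 <= (1 - beta) * s by rewrite mulr_ge0// subr_ge0 ltW.
  lra.
have xa : 8 * (a + 4) / c1 <= x.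
  have xa0 : 0 < 8 * (a + 4) / c1 by rewrite divr_gt0// mulr_gt0//; lra.
  rewrite (_ : 8 * (a + 4) / c1 = expR (ln (8 * (a + 4) / c1))); last by rewrite lnK.
  by rewrite ler_expR ler_pdivlMr// mulrC.
have {}xa : a + 4 <= c1 / 8 * x.
  by move: xa; rewrite ler_pdivrMr//; lra.
apply: (@le_trans _ _ (c1 / 8 * (x * x))); last by rewrite ler_wpM2l// divr_ge0// ltW.
apply: (@le_trans _ _ ((a + 4) * x)).
  have : a <= a * x by rewrite ler_peMr// ltW.
  lra.
by rewrite mulrA ler_wpM2r//; lra.
Qed.

(** * Unfolding the balls and final numerical bounds *)

Lemma lp_norm1E (R : realType) (m : nat) (x : 'cV[R]_m) :
  lp_norm 1%:E x = \sum_i `|x i 0|.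
Proof.
rewrite /lp_norm invr1 powRr1; last by apply: sumr_ge0 => i _; exact: powR_ge0.
by apply: eq_bigr => i _; rewrite powRr1.
Qed.

Lemma lp_ball1P (R : realType) (m : nat) (x : 'cV[R]_m) :
  lp_ball m 1%:E x <-> \sum_i `|x i 0| <= 1.
Proof. by rewrite -lp_norm1E. Qed.

Lemma lp_ball_oo (R : realType) (m : nat) (x : 'cV[R]_m) :
  lp_ball m +oo x -> forall i, `|x i 0| <= 1.
Proof.
rewrite /lp_ball/= => x1 i; apply: le_trans x1.
exact: (le_bigmax _ (fun i => `|x i 0|)).
Qed.

Lemma lp_ball_2 (R : realType) (m : nat) (x : 'cV[R]_m) :
  lp_ball m 2%:E x -> \sum_i x i 0 ^+ 2 <= 1.
Proof.
rewrite /lp_ball/=; have -> : \sum_i `|x i 0| `^ 2 = \sum_i x i 0 ^+ 2.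
  by apply: eq_bigr => i _; rewrite -[2]/(2%:R) powR_mulrn// real_normK ?num_real.
have s0 : 0 <= \sum_i x i 0 ^+ 2 by apply: sumr_ge0 => i _; exact: sqr_ge0.
by rewrite powR12_sqrt// -[X in _ <= X -> _]sqrtr1 ler_sqrt.
Qed.

Lemma lattice_mesh_le (R : realType) (u v : R) (k : nat) : 0 < u < 1 -> 0 < v < 1 ->
  k%:R * ((1 - v) / (64 * 2 ^+ k) * (u * (1 - v) / 8) / 8) <= 1 / 2.
Proof.
move=> /andP[u0 u1] /andP[v0 v1].
have v2 : 0 <= 1 - v <= 1 by apply/andP; split; lra.
move: v2; set c := 1 - v => /andP[c0 c1]; clearbody c.
have t1 : u * c <= 1 by rewrite mulr_ile1// ltW.
have t0 : 0 <= u * c by rewrite mulr_ge0// ltW.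
have s1 : c * (u * c) <= 1 by rewrite mulr_ile1.
have k2 : k%:R <= 2 ^+ k :> R by rewrite -natrX ler_nat ltnW// ltn_expl.
have k20 : 0 < 2 ^+ k :> R by rewrite exprn_gt0.
apply: (@le_trans _ _ (2 ^+ k * (c / (64 * 2 ^+ k) * (u * c / 8) / 8))).
  by rewrite ler_wpM2r// !mulr_ge0 ?invr_ge0 ?mulr_ge0// ltW.
rewrite (_ : 2 ^+ k * _ = c * (u * c) / 4096); first lra.
by field; rewrite gt_eqF.
Qed.

(** The exponent N p / 4 = n q p / 4 is split in two: one half absorbs the size W^n of the net, the
    other dominates n q^(1 - beta) = n^beta N^(1 - beta). *)
Lemma failure_bound (R : realType) (n N : nat) (W p beta : R) :
  (0 < n)%N -> (0 < N)%N -> 0 < W ->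
  let q := N%:R / n%:R in
  ln W <= q * p / 8 -> q `^ (1 - beta) <= q * p / 8 ->
  W ^+ n * expR (- (N%:R * p / 4)) <=
    4 * expR (- (n%:R `^ beta * N%:R `^ (1 - beta))).
Proof.
move=> n0 N0 W0 q H1 H2.
have n0R : 0 < n%:R :> R by rewrite ltr0n.
have q0 : 0 < q by rewrite divr_gt0// ltr0n.
have NE : N%:R = n%:R * q by rewrite mulrC divfK// gt_eqF.
clearbody q.
have -> : n%:R `^ beta * N%:R `^ (1 - beta) = n%:R * q `^ (1 - beta).
  rewrite NE powRM ?(ltW n0R) ?(ltW q0)// mulrA -powRD; last by rewrite addrC subrK oner_eq0.
  by rewrite addrC subrK powRr1 ?ltW.
have -> : W ^+ n = expR (n%:R * ln W) by rewrite expRM_natl lnK.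
rewrite -expRD; apply: (@le_trans _ _ (expR (- (n%:R * q `^ (1 - beta))))).
  rewrite ler_expR NE.
  have := ler_wpM2l (ltW n0R) H1; have := ler_wpM2l (ltW n0R) H2; lra.
by rewrite ler_peMl ?expR_ge0//; lra.
Qed.

Theorem theorem4p1 (R : realType) :
  exists2 c : R, 0 < c &
  forall u v beta : R, 0 < u < 1 -> 0 < v < 1 -> 0 < beta < 1 ->
  exists M C : R, [/\ 0 < M, 0 < C &
  forall n N : nat, (0 < n)%N -> (0 < N)%N -> M * n%:R <= N%:R ->
  forall (d : measure_display) (T : measurableType d) (P : probability T R)
    (xi : 'I_N -> 'I_n -> {RV P >-> R}),
    mutually_independent (fun ij : 'I_N * 'I_n => xi ij.1 ij.2) ->
    (forall i j, symmetric_rv (xi i j)) ->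
    (forall i j, ('V_P[xi i j] = 1)%E) ->
    (forall i j k, same_distribution P (xi i j) (xi i k)) ->
    (forall i j, (levy_concentration (xi i j) u <= v%:E)%E) ->
    ((1 - 4 * expR (- (c * (n%:R `^ beta * N%:R `^ (1 - beta)))))%:E <=
     P [set w | dilate C (lp_ball n +oo `&`
                          dilate (Num.sqrt (ln (N%:R / n%:R))) (lp_ball n 2%:E))
                `<=` K_N xi w])%E].
Proof.
exists 1 => // u v beta uI vI bI.
have [/andP[u0 u1] /andP[v0 v1] /andP[b0 b1]] := And3 uI vI bI.
have [M M1 HM] := parameter_choice uI vI bI.
pose t := u * (1 - v) / 8.
have t0 : 0 < t by rewrite /t divr_gt0// mulr_gt0// subr_gt0.
(* As k exceeds (beta / 2) ln q, the squared radius ln q is at most kappa k. *)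
pose kappa := 2 / beta; have kappa0 : 0 < kappa by rewrite divr_gt0.
pose C := t / 4 / Num.sqrt (kappa + 1).
have kappa1 : 0 < Num.sqrt (kappa + 1) by rewrite sqrtr_gt0 addr_gt0.
have C0 : 0 < C by rewrite divr_gt0// divr_gt0.
exists M, C; split => //; first by apply: lt_le_trans M1.
move=> n N n0 N0 MN d T P xi indep sym var1 _ small.
have n0R : 0 < n%:R :> R by rewrite ltr0n.
have N0R : 0 < N%:R :> R by rewrite ltr0n.
pose q : R := N%:R / n%:R.
have Mq : M <= q by rewrite ler_pdivlMr.
have q1 : 1 <= q by exact: le_trans Mq.
have q0 : 0 < q by rewrite divr_gt0.
have lnq0 : 0 <= ln q by exact: ln_ge0.
(* The successor keeps k positive when (beta / 2) ln q < 1 and makes k exceed that quantity. *)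
pose k := (Num.truncn (beta / 2 * ln q)).+1.
pose p := (1 - v) / (64 * 2 ^+ k); pose delta := p * t / 8.
have [H1 H2] : ln (2 * expR 1 * (1 + (delta^-1 + 1))) <= q * p / 8 /\
  q `^ (1 - beta) <= q * p / 8 := HM q Mq.
have k20 : 0 < 2 ^+ k :> R by rewrite exprn_gt0.
have p0 : 0 < p by rewrite divr_gt0 ?mulr_gt0// subr_gt0.
(* The concentration function is used at its centre 0. *)
have small' i j : (P [set w | (`|xi i j w| <= u)%R] <= v%:E)%E.
  apply: le_trans (small i j); apply: ereal_sup_ubound; exists 0 => //.
  by under eq_set do rewrite subr0.
set E := [set w | _ `<=` _].
pose S : set ('I_n -> R) := [set x | dilate C (lp_ball n +oo `&`
  dilate (Num.sqrt (ln q)) (lp_ball n 2%:E)) (\col_j x j)].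
have EE : E = [set w | forall x, S x -> exists2 a : 'I_N -> R,
    \sum_i `|a i| <= 1 & forall j, \sum_i xi i j w * a i = x j].
  apply/seteqP; split => w /= Ew.
    move=> x Sx; have [a a1 ax] := Ew _ Sx.
    exists (fun i => a i 0); first exact/lp_ball1P.
    move=> j; have := congr1 (fun A : 'cV[R]_n => A j 0) ax; rewrite !mxE => <-.
    by apply: eq_bigr => i _; rewrite !mxE.
  move=> x Sx; have xE : x = \col_j x j 0.
    by apply/matrixP => i j; rewrite mxE ord1.
  have [|a a1 ax] := Ew (fun j => x j 0); first by rewrite /S/= -xE.
  exists (\col_i a i).
    by apply/lp_ball1P; under eq_bigr do rewrite mxE.
  apply/matrixP => j j'; rewrite ord1 !mxE -ax.
  by apply: eq_bigr => i _; rewrite !mxE.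
have mE : measurable E.
  rewrite EE; apply: (@measurable_hull_event _ _ R N n (fun i j => xi i j)) => // i j.
have delta0 : 0 < delta by rewrite divr_gt0// mulr_gt0.
have kd : k%:R * delta <= 1 / 2 by exact: lattice_mesh_le.
apply: le_trans (@all_directions_event _ T R P N n k xi indep sym var1 u v u0 v0 v1 small' N0 n0 E mE kd _).
  rewrite lee_fin lerD2l lerN2 mul1r; apply: failure_bound => //.
  by rewrite !mulr_gt0 ?expR_gt0// !addr_gt0// invr_gt0.
move=> w Hw; rewrite EE => x [x' [x1 [z z2 zE]] xE].
have x2 : \sum_j x' j 0 ^+ 2 <= ln q.
  rewrite -zE; under eq_bigr do rewrite mxE exprMn sqr_sqrtr//.
  by rewrite -mulr_sumr ler_piMr// lp_ball_2.
have Lk : ln q <= kappa * k%:R.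
  rewrite /kappa mulrAC ler_pdivlMr//.
  have := truncnS_gt (beta / 2 * ln q); rewrite -/k => /ltW.
  by rewrite mulrAC ler_pdivrMr// mulrC (mulrC k%:R).
have CE : C * Num.sqrt (kappa + 1) <= t / 4 by rewrite /C divfK// gt_eqF.
have [a a1 ax] := @dilate_sub_hull R N n k (fun i j => xi i j w) (t / 4) (ln q) kappa C
   isT lnq0 kappa0 Lk (ltW C0) CE Hw (fun j => x' j 0) (lp_ball_oo x1) x2.
exists a => // j; rewrite ax.
by have := congr1 (fun A : 'cV[R]_n => A j 0) xE; rewrite !mxE.
Qed.
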